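(* In the setting described in the context (homogeneous ensembles), for $M\in\{1,2,\dots\}\cup\{+\infty\}$, let $$\mathcal R_M(\delta,c)=\frac1M\alpha^2+\Big(1-\frac1M\Big)\eta_G\alpha^2\qquad(\text{with }1/M:=0\text{ if }M=+\infty)$$ be the limiting risk, where $\alpha=\alpha(\delta,c)$ and $\eta_G=\eta_G(\delta,c)$ are defined by Systems A and B with parameters $(\delta,c)$. Then the map $\delta\mapsto\inf_{c\in(0,1)}\mathcal R_M(\delta,c)$ is non-increasing over $\delta\in(0,\infty)$ for all $M\in\{1,2,\dots\}\cup\{+\infty\}$.
   Context: $F_\theta,F_z$ are probability distributions on $\mathbb R$. $\ell:\mathbb R\to\mathbb R$ is proper, closed, convex, differentiable with Lipschitz derivative $\ell'$, $\min_x\ell(x)=\ell(0)$; $\phi:\mathbb R\to\mathbb R\cup\{+\infty\}$ is proper, closed, convex with $\min_x\phi(x)=\phi(0)$. For a proper closed convex $f$ and $\tau>0$: $\mathrm{prox}_f(x;\tau)=\arg\min_{y}\{f(y)+\frac1{2\tau}(x-y)^2\}$, $\mathrm{env}_f(x;\tau)=\min_{y}\{f(y)+\frac1{2\tau}(x-y)^2\}$, $\mathrm{env}_f'(x;\tau)=\frac{\partial}{\partial x}\mathrm{env}_f(x;\tau)=\frac1\tau(x-\mathrm{prox}_f(x;\tau))$. System A with parameters $(\delta,c)$, in $(\alpha,\beta,\kappa,\nu)\in\mathbb R_{>0}^4$: $$\alpha^2=\mathbb E\Big[\big(\tfrac1\nu\mathrm{env}_\phi'(\Theta+\tfrac\beta\nu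 H;\tfrac1\nu)-\tfrac\beta\nu H\big)^2\Big],\qquad \beta^2=c\delta\,\mathbb E\big[\mathrm{env}_\ell'(Z+\alpha G;\kappa)^2\big],$$ $$\kappa\beta=\mathbb E\Big[\big(\tfrac1\nu\mathrm{env}_\phi'(\Theta+\tfrac\beta\nu H;\tfrac1\nu)-\tfrac\beta\nu H\big)(-H)\Big],\qquad \nu\alpha=c\delta\,\mathbb E\big[\mathrm{env}_\ell'(Z+\alpha G;\kappa)\,G\big],$$ where $H,G\sim N(0,1)$, $\Theta\sim F_\theta$, $Z\sim F_z$ are mutually independent. Regularity conditions: (1) for all $a\in\mathbb R$, $\mathbb E[\ell_+'(aG+Z)^2]<\infty$ and $\mathbb E[\phi_+'(aH+\Theta)^2]<\infty$, where $f_+'(x)=\sup_{s\in\partial f(x)}|s|$; (2) $\mathbb P(\Theta\ne0)>0$; (3) for all $\delta\in(0,\infty)$ and $c\in(0,1)$, System A admits a unique positive solution $(\alpha,\beta,\kappa,\nu)\in\mathbb R_{>0}^4$; (4) there exists an interval on which $\ell'$ is strictly increasing, and the support of $F_z$ is $\mathbb R$. System B (homogeneous case) with parameters $(\delta,c)$, in $(\eta_G,\eta_H)\in[-1,1]^2$: $$\eta_G=\frac1{\alpha^2}\,\mathbb E\Big[\big(\tfrac1\nu\mathrm{env}_\phi'(\Theta+\tfrac\beta\nu H;\tfrac1\nu)-\tfrac\beta\nu H\big)\big(\tfrac1{\nu}\mathrm{env}_{\phi}'(\Theta+\tfrac{\beta}{\nu}\tilde H;\tfrac1{\nu})-\tfrac{\beta}{\nu}\tilde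 H\big)\Big],$$ $$\eta_H=\frac{c^2\delta}{\beta^2}\,\mathbb E\big[\mathrm{env}_\ell'(Z+\alpha G;\kappa)\,\mathrm{env}_{\ell}'(Z+\alpha\tilde G;\kappa)\big],$$ with $(G,\tilde G)$ and $(H,\tilde H)$ centered bivariate Gaussian with unit variances and correlations $\eta_G$ and $\eta_H$ respectively, $\Theta\sim F_\theta$, $Z\sim F_z$, and $(G,\tilde G),(H,\tilde H),\Theta,Z$ mutually independent. System B has a unique solution $(\eta_G,\eta_H)$. ($\mathcal R_M(\delta,c)$ is, for finite $M$, the probability limit of $\frac1p\|\tilde\theta_M-\theta\|_2^2$ for the average $\tilde\theta_M$ of $M$ regularized M-estimators with loss $\ell$ and regularizer $\phi$ fit on independent random subsamples of size $k$, as $n/p\to\delta$, $k/n\to c$.) *)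

(* Defs.v *)
From HB Require Import structures.
From mathcomp Require Import all_boot all_order all_algebra.
From mathcomp Require Import all_classical all_reals all_analysis.

Set Implicit Arguments.
Unset Strict Implicit.
Unset Printing Implicit Defensive.

Import Order.TTheory GRing.Theory Num.Theory.
Import numFieldNormedType.Exports.

Local Open Scope classical_set_scope.
Local Open Scope ring_scope.

Section convex_analysis.
Context {R : realType}.
Implicit Types (f : R -> \bar R) (x tau : R).

Definition proper f : Prop :=
  (exists x, (f x < +oo)%E) /\ (forall x, (-oo < f x)%E).

Definition convex f : Prop :=
  forall x y t : R, 0 <= t <= 1 ->
    (f (t * x + (1 - t) * y)%R <= t%:E * f x + (1 - t)%:E * f y)%E.

(* A function is closed when its epigraph is, i.e. when it is lower
   semicontinuous. *)
Definition proper_closed_convex f : Prop :=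
  [/\ proper f, lower_semicontinuous f & convex f].

Definition minimum_at f x : Prop := forall y, (f x <= f y)%E.

Definition subdiff f x : set R :=
  [set s | forall y, (f x + (s * (y - x))%:E <= f y)%E].

(* The supremum is taken in [0, +oo]: it is 0 where the subdifferential is
   empty (in particular outside the domain of f). *)
Definition subdiff_sup f x : \bar R :=
  maxe 0%E (ereal_sup [set `|s|%:E | s in subdiff f x]).

Definition env f x tau : \bar R :=
  ereal_inf [set (f y + ((2 * tau)^-1 * (x - y) ^+ 2)%:E)%E | y in setT].

(* For proper closed convex f and tau > 0 the envelope is finite, so fine loses
   nothing. *)
Definition denv f x tau : R := (fun u => fine (env f u tau))^`()%classic x.

End convex_analysis.

Section gaussian.
Context {R : realType}.

Local Notation mR := (measurableTypeR R).

Definition stdnormal : probability mR R := normal_prob 0 1.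

Definition correlate (rho : R) (w : mR * mR) : mR * mR :=
  (w.1, rho * w.1 + Num.sqrt (1 - rho ^+ 2) * w.2).

Lemma measurable_correlate (rho : R) :
  measurable_fun [set: mR * mR] (correlate rho).
Proof.
apply: measurable_fun_pair => //=.
by apply: measurable_realfun.measurable_funD;
  apply: measurable_realfun.measurable_funM.
Qed.

HB.instance Definition _ (rho : R) :=
  isMeasurableFun.Build _ _ (mR * mR)%type (mR * mR)%type
    (correlate rho) (measurable_correlate rho).

(* Law of a centered Gaussian pair with unit variances and correlation
   rho \in [-1, 1], as the image of a standard Gaussian pair. *)
Definition binormal (rho : R) : probability (mR * mR)%type R :=
  distribution (stdnormal \x stdnormal)%E (correlate rho).

End gaussian.

Section systems.
Context {R : realType}.
Variables (Ftheta Fz : probability (measurableTypeR R) R).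
Variables (ell : R -> R) (phi : R -> \bar R).

Definition reg_score (beta nu theta h : R) : R :=
  nu^-1 * denv phi (theta + beta / nu * h) nu^-1 - beta / nu * h.

Definition loss_score (alpha kappa z g : R) : R :=
  denv (EFin \o ell) (z + alpha * g) kappa.

(* w = (theta, h) under Ftheta \x stdnormal, w = (z, g) under
   Fz \x stdnormal. *)
Definition systemA (delta c alpha beta kappa nu : R) : Prop :=
  [/\ [/\ 0 < alpha, 0 < beta, 0 < kappa & 0 < nu],
      (alpha ^+ 2)%:E =
        'E_(Ftheta \x stdnormal)[fun w => (reg_score beta nu w.1 w.2 ^+ 2)%R]%E,
      (beta ^+ 2)%:E =
        ((c * delta)%:E * 'E_(Fz \x stdnormal)[fun w =>
           (loss_score alpha kappa w.1 w.2 ^+ 2)%R])%E,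
      (kappa * beta)%:E =
        'E_(Ftheta \x stdnormal)[fun w =>
           (reg_score beta nu w.1 w.2 * - w.2)%R]%E &
      (nu * alpha)%:E =
        ((c * delta)%:E * 'E_(Fz \x stdnormal)[fun w =>
           (loss_score alpha kappa w.1 w.2 * w.2)%R])%E].

(* w = (theta, (h, h')) under Ftheta \x binormal etaH, w = (z, (g, g')) under
   Fz \x binormal etaG. *)
Definition systemB (delta c alpha beta kappa nu etaG etaH : R) : Prop :=
  [/\ -1 <= etaG <= 1, -1 <= etaH <= 1,
      etaG%:E =
        (((alpha ^+ 2)^-1)%:E * 'E_(Ftheta \x binormal etaH)[fun w =>
           (reg_score beta nu w.1 w.2.1 * reg_score beta nu w.1 w.2.2)%R])%E &
      etaH%:E =
        ((c ^+ 2 * delta / beta ^+ 2)%:E * 'E_(Fz \x binormal etaG)[fun w =>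
           (loss_score alpha kappa w.1 w.2.1 *
            loss_score alpha kappa w.1 w.2.2)%R])%E].

Definition measure_support (mu : set R -> \bar R) : set R :=
  [set x | forall U : set R, open U -> U x -> (0 < mu U)%E].

Definition regularity : Prop :=
  [/\ forall a : R,
        (\int[Fz \x stdnormal]_w
           subdiff_sup (EFin \o ell) (a * w.2 + w.1)%R ^+ 2 < +oo)%E /\
        (\int[Ftheta \x stdnormal]_w
           subdiff_sup phi (a * w.2 + w.1)%R ^+ 2 < +oo)%E,
      (0 < Ftheta [set theta | theta != 0%R])%E,
      forall delta c : R, 0 < delta -> 0 < c < 1 ->
        exists! s : R * R * R * R,
          systemA delta c s.1.1.1 s.1.1.2 s.1.2 s.2 &
      (exists a b : R, a < b /\
        {in `]a, b[ &, {homo ell^`()%classic : x y / x < y}}) /\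
      measure_support Fz = [set: R]].

End systems.

(* The ensemble size is Some m for a finite m and None for +oo. *)
Definition inv_size {R : realType} (M : option nat) : R :=
  if M is Some m then m%:R^-1 else 0.

Definition limit_risk {R : realType} (M : option nat) (alpha etaG : R) : R :=
  inv_size M * alpha ^+ 2 + (1 - inv_size M) * (etaG * alpha ^+ 2).

(* Main.v *)
(* Only the product c * delta enters System A. Given delta1 <= delta2 and c, the
   choice c' = c * delta1 / delta2 <= c at delta2 therefore gives the same
   (alpha, beta, kappa, nu), and the risks differ only through etaG. System B
   reads etaG = F (c * G etaG), where F and G are expectations of products
   E[f(X) f(Y)] as functions of the correlation of the Gaussian pair (X, Y),
   normalized by F 1 = G 1 = 1. Such functions are nonnegative, nondecreasing and
   convex on [0, 1], which forces the fixed point to be nonnegative and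
   nondecreasing in c.

   The inequalities on F are obtained by splitting a correlated pair as
   (a u + b v, a u + b v') with a^2 + b^2 = 1, where u is shared: conditionally on
   u, the expectation becomes the square of an expectation when v and v' are
   independent. The law of such a pair is computed from the rotation invariance
   of the standard Gaussian in the plane. *)
Require Import Defs.
From mathcomp Require Import all_boot all_order all_algebra.
From mathcomp Require Import all_classical all_reals all_analysis.
From mathcomp Require Import measurable_realfun normal_distribution.
From mathcomp Require Import ring lra.

Set Implicit Arguments.
Unset Strict Implicit.
Unset Printing Implicit Defensive.

Import Order.TTheory GRing.Theory Num.Theory.
Import numFieldNormedType.Exports.

Local Open Scope classical_set_scope.
Local Open Scope ring_scope.

(** * Monotone fixed points of noise stability functions *)
Section noise_stability.
Context {R : realType}.
Implicit Types F G : R -> R.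

(* The inequalities satisfied by F(rho) = E[f(X) f(Y)] for standard Gaussians X
   and Y of correlation rho. Each holds for power series with nonnegative
   coefficients, but here they are proved without Hermite expansions. *)
Definition noise_stability F : Prop :=
  [/\ forall x, 0 <= x <= 1 -> 0 <= F x,
      forall x t, 0 <= x -> 0 <= t -> x + t <= 1 -> F (x - t) <= F (x + t) &
      forall x t, 0 <= x -> 0 <= t -> x + t <= 1 ->
        2 * F x <= F (x + t) + F (x - t)].

Lemma noise_stability_homo F a b : noise_stability F ->
  0 <= a -> a <= b -> b <= 1 -> F a <= F b.
Proof.
move=> [_ F1 _] a0 ab b1.
have := F1 ((a + b) / 2) ((b - a) / 2).
have -> : (a + b) / 2 - (b - a) / 2 = a by field.
have -> : (a + b) / 2 + (b - a) / 2 = b by field.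
by apply; lra.
Qed.

(* Halving the distance to the nearer endpoint at most halves G, so G <= K / 2^n
   for every n; no continuity is needed. *)
Lemma midpoint_convex_le0 G (K : R) : G 0 <= 0 -> G 1 <= 0 ->
  (forall s, 0 <= s <= 1 -> G s <= K) ->
  (forall a b, 0 <= a -> a <= b -> b <= 1 -> 2 * G ((a + b) / 2) <= G a + G b) ->
  forall s, 0 <= s <= 1 -> G s <= 0.
Proof.
move=> G0 G1 GK Gmid.
have GKn n s : 0 <= s <= 1 -> 2 ^+ n * G s <= K.
  elim: n s => [|n ih] s s01; first by rewrite expr0 mul1r GK.
  have n0 : 0 <= 2 ^+ n :> R by rewrite exprn_ge0.
  rewrite exprSr -mulrA; have [s2|s2] := leP s (1 / 2).
  - have h : 2 * G s <= G (2 * s).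
      have := Gmid 0 (2 * s); rewrite add0r (_ : 2 * s / 2 = s); last by field.
      by move=> h; have := h ltac:(lra) ltac:(lra) ltac:(lra); lra.
    by apply: (le_trans (ler_wpM2l n0 h)); apply: ih; lra.
  - have h : 2 * G s <= G (2 * s - 1).
      have := Gmid (2 * s - 1) 1; rewrite (_ : (2 * s - 1 + 1) / 2 = s); last by field.
      by move=> h; have := h ltac:(lra) ltac:(lra) ltac:(lra); lra.
    by apply: (le_trans (ler_wpM2l n0 h)); apply: ih; lra.
move=> s s01; rewrite leNgt; apply/negP => Gs0.
have [n] : exists n, K / G s < n%:R.
  by exists (Num.truncn (K / G s)).+1; rewrite truncnS_gt.
rewrite ltr_pdivrMr// => Kn.
have : n%:R * G s <= 2 ^+ n * G s.
  by rewrite ler_pM2r// -natrX ler_nat ltnW// ltn_expl.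
by have := GKn n s s01; lra.
Qed.

(** The excess of F over its chord is midpoint convex and vanishes at both ends. Monotonicity bounds
    it by [F b - F a], the uniform bound required by [midpoint_convex_le0]. *)
Lemma noise_stability_convex F a b s : noise_stability F ->
  0 <= a -> a <= b -> b <= 1 -> 0 <= s <= 1 ->
  F ((1 - s) * a + s * b) <= (1 - s) * F a + s * F b.
Proof.
move=> FP a0 ab b1; have [_ _ F2] := FP.
pose G s := F ((1 - s) * a + s * b) - ((1 - s) * F a + s * F b).
have Fab : F a <= F b by exact: noise_stability_homo.
suff : forall s, 0 <= s <= 1 -> G s <= 0.
  by move=> h s01; have := h s s01; rewrite /G subr_le0.
apply: (@midpoint_convex_le0 _ (F b - F a)).
- by rewrite /G !subr0 !mul1r !mul0r !addr0 subrr.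
- by rewrite /G !subrr !mul1r !mul0r !add0r subrr.
- move=> r r01; rewrite /G.
  have : F ((1 - r) * a + r * b) <= F b by apply: noise_stability_homo => //; nra.
  nra.
- move=> r q r0 rq q1; rewrite /G.
  set u := (1 - r) * a + r * b; set v := (1 - q) * a + q * b.
  have uv : u <= v by rewrite /u /v; nra.
  have u0 : 0 <= u by rewrite /u; nra.
  have v1 : v <= 1 by rewrite /v; nra.
  have -> : (1 - (r + q) / 2) * a + (r + q) / 2 * b = (u + v) / 2.
    by rewrite /u /v; field.
  have := F2 ((u + v) / 2) ((v - u) / 2).
  have -> : (u + v) / 2 - (v - u) / 2 = u by field.
  have -> : (u + v) / 2 + (v - u) / 2 = v by field.
  move=> h; have := h ltac:(lra) ltac:(lra) ltac:(lra).
  nra.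
Qed.

(** * Fixed points of x = F (c * G x) *)

Section fixed_point.
Variables (F G : R -> R).
Hypotheses (FP : noise_stability F) (GP : noise_stability G).
Hypotheses (F1 : F 1 = 1) (G1 : G 1 = 1).

(** A nondecreasing convex function of a convex one, along the chord from x to 1, where G is 1. *)
Let comp_convex c x s : 0 <= c <= 1 -> 0 <= x <= 1 -> 0 <= s <= 1 ->
  F (c * G ((1 - s) * x + s)) <= (1 - s) * F (c * G x) + s * F c.
Proof.
move=> c01 x01 s01; have [G0 _ _] := GP.
have Gx1 : G x <= 1 by rewrite -G1; apply: noise_stability_homo => //; lra.
have Gx0 : 0 <= G x by exact: G0.
have cG : 0 <= c * G x <= c by nra.
have h : G ((1 - s) * x + s) <= (1 - s) * G x + s.
  have := @noise_stability_convex G x 1 s GP.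
  by rewrite G1 !mulr1; apply; lra.
apply: (@le_trans _ _ (F ((1 - s) * (c * G x) + s * c))).
  apply: noise_stability_homo => //.
  - by apply: mulr_ge0; [lra | apply: G0; nra].
  - by have := @ler_wpM2l _ c ltac:(lra) _ _ h; lra.
  - by nra.
by apply: noise_stability_convex => //; lra.
Qed.

Let F_le_interp c : 0 <= c <= 1 -> F c <= (1 - c) * F 0 + c.
Proof.
move=> c01; have := @noise_stability_convex F 0 1 c FP.
by rewrite F1 mulr0 add0r !mulr1; apply; lra.
Qed.

(** If x < 0, put y = - x. When c * G x >= c * G 0, the argument of F lies in [0, 1], where F is
    nonnegative. Otherwise reflect c * G x about c * G 0: the midpoint inequalities of F and G, with
    [comp_convex] at 0, give (1 + y) F (c * G 0) <= y (F c - 1). This forces F 0 = 0, hence F c <= c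
    < 1 and F (c * G 0) < 0. *)
Lemma noise_fixpoint_ge0 c x : 0 <= c < 1 -> -1 <= x <= 1 ->
  x = F (c * G x) -> 0 <= x.
Proof.
move=> c01 x11 xE; rewrite leNgt; apply/negP => x0.
have [F0 _ F2] := FP; have [G0 GJ1 GJ2] := GP.
pose y := - x; have y01 : 0 < y <= 1 by rewrite /y; lra.
have Gy : G 0 <= G y by apply: noise_stability_homo => //; lra.
have Gy1 : G y <= 1 by rewrite -G1; apply: noise_stability_homo => //; lra.
have G00 : 0 <= G 0 by apply: G0; lra.
have Gxy : 2 * G 0 <= G y + G x.
  have := GJ2 0 y; rewrite add0r sub0r opprK; apply; lra.
have [vu|uv] := leP (c * G 0) (c * G x).
  have : 0 <= F (c * G x).
    by apply: F0; have := GJ1 0 y; rewrite add0r sub0r opprK; nra.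
  by lra.
have h1 : 2 * F (c * G 0) <= F (2 * (c * G 0) - c * G x) + F (c * G x).
  have := F2 (c * G 0) (c * G 0 - c * G x).
  rewrite (_ : c * G 0 - (c * G 0 - c * G x) = c * G x); last by ring.
  rewrite (_ : c * G 0 + (c * G 0 - c * G x) = 2 * (c * G 0) - c * G x);
    last by ring.
  by apply; nra.
have h2 : F (2 * (c * G 0) - c * G x) <= F (c * G y).
  by apply: noise_stability_homo => //; nra.
have h3 := @comp_convex c 0 y.
rewrite mulr0 add0r in h3.
have {}h3 := h3 ltac:(lra) ltac:(lra) ltac:(lra).
have h4 : F c <= (1 - c) * F 0 + c by apply: F_le_interp; lra.
have h5 : 0 <= F 0 by apply: F0; lra.
have h6 : F 0 <= F (c * G 0) by apply: noise_stability_homo => //; nra.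
have h7 : 2 * F (c * G 0) + y <= (1 - y) * F (c * G 0) + y * F c.
  by rewrite {1}/y {1}xE; lra.
have h8 : F c <= 1 by rewrite -F1; apply: noise_stability_homo => //; lra.
have h9 : F (c * G 0) <= 0 by nra.
have F00 : F 0 = 0 by lra.
have Fc : F c < 1 by rewrite F00 in h4; lra.
nra.
Qed.

(** If x < x', write x' = (1 - s) x + s. Convexity gives x' <= F (c * G x') <= (1 - s) x + s F c, so
    F c >= 1; but F c <= (1 - c) F 0 + c, with F 0 <= x < 1 and c < 1. *)
Lemma noise_fixpoint_le c c' x x' : 0 <= c' -> c' <= c -> c < 1 ->
  -1 <= x <= 1 -> -1 <= x' <= 1 ->
  x = F (c * G x) -> x' = F (c' * G x') -> x' <= x.
Proof.
move=> c'0 c'c c1 x11 x'11 xE x'E; rewrite leNgt; apply/negP => xx'.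
have [F0 _ _] := FP; have [G0 _ _] := GP.
have x0 : 0 <= x by apply: noise_fixpoint_ge0 xE => //; lra.
have x'0 : 0 <= x' by lra.
have Gx'0 : 0 <= G x' by apply: G0; lra.
have Gx'1 : G x' <= 1 by rewrite -G1; apply: noise_stability_homo => //; lra.
have Gx0 : 0 <= G x by apply: G0; lra.
have Gx1 : G x <= 1 by rewrite -G1; apply: noise_stability_homo => //; lra.
have h1 : x' <= F (c * G x').
  by rewrite {1}x'E; apply: noise_stability_homo => //; nra.
pose s := (x' - x) / (1 - x).
have sE : s * (1 - x) = x' - x by rewrite /s divfK//; lra.
have s01 : 0 < s <= 1.
  by rewrite /s divr_gt0 ?ler_pdivrMr; lra.
have h2 := @comp_convex c x s ltac:(lra) ltac:(lra) ltac:(lra).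
have x'E' : (1 - s) * x + s = x' by lra.
rewrite x'E' -xE in h2.
have h3 : 1 <= F c by nra.
have h4 : F c <= (1 - c) * F 0 + c by apply: F_le_interp; lra.
have h5 : F 0 <= x by rewrite xE; apply: noise_stability_homo => //; nra.
nra.
Qed.

End fixed_point.
End noise_stability.

(** * Rotation invariance of Gaussian pairs *)
Section gaussian_pairs.
Context {R : realType}.
Local Notation mR := (measurableTypeR R).
Local Notation leb := (@lebesgue_measure R).
Local Notation gam := (@stdnormal R).
Local Notation pdf := (@normal_pdf R 0 1).
Local Open Scope ereal_scope.

(** The Radon-Nikodym derivative of [stdnormal] and the normal density have the same integral over
    every measurable set, so they agree almost everywhere. *)
Lemma ge0_integral_stdnormal (f : mR -> \bar R) :
  measurable_fun setT f -> (forall x, 0 <= f x) ->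
  \int[gam]_x f x = \int[leb]_x (f x * (pdf x)%:E).
Proof.
move=> mf f0; have dom := @normal_prob_dominates R 0 1.
rewrite -(Radon_Nikodym_SigmaFinite.change_of_variables dom f0 measurableT mf).
apply: ae_eq_integral => //.
- apply: emeasurable_funM => //; apply: (measurable_int leb).
  exact: Radon_Nikodym_SigmaFinite.f_integrable.
- apply: emeasurable_funM => //; apply/measurable_EFinP.
  exact: measurable_normal_pdf.
- apply: ae_eqe_mul2l; apply: integral_ae_eq => //.
  + exact: Radon_Nikodym_SigmaFinite.f_integrable.
  + apply/measurable_EFinP; exact: measurable_normal_pdf.
  + by move=> A _ mA; rewrite -Radon_Nikodym_SigmaFinite.f_integral.
Qed.

Lemma measurable_translate (a : R) :
  measurable_fun setT ((fun x => x + a)%R : mR -> mR).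
Proof. exact: measurable_funD. Qed.

(** Uniqueness of Lebesgue measure reduces the claim to half-open intervals. *)
Lemma lebesgue_measure_translate (a : R) (A : set mR) : measurable A ->
  pushforward leb ((fun x => x + a)%R : mR -> mR) A = leb A.
Proof.
move=> mA; apply/esym/lebesgue_measure_unique => //.
  exact: measurable_translate.
move=> ? _ [[x y]] _ <-; rewrite /= /pushforward.
rewrite (_ : _ @^-1` _ = `](x - a)%R, (y - a)%R]%classic); last first.
  apply/seteqP; split => z /=; rewrite !in_itv/=; lra.
rewrite !lebesgue_measure_itv/= !lte_fin ltrD2r.
by case: ifP => // _; rewrite -!EFinD; congr EFin; lra.
Qed.

Lemma ge0_integral_translate (a : R) (f : mR -> \bar R) :
  measurable_fun setT f -> (forall x, 0 <= f x) ->
  \int[leb]_x f (x + a)%R = \int[leb]_x f x.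
Proof.
move=> mf f0; have mT := measurable_translate a.
transitivity (\int[pushforward leb ((fun x => x + a)%R : mR -> mR)]_x f x).
  by rewrite ge0_integral_pushforward.
by apply: eq_measure_integral => A mA _; exact: lebesgue_measure_translate.
Qed.

Lemma ge0_integral_reflect (f : mR -> \bar R) :
  measurable_fun setT f -> (forall x, 0 <= f x) ->
  \int[leb]_x f (- x)%R = \int[leb]_x f x.
Proof.
move=> mf f0; have mT : measurable_fun setT (-%R : mR -> mR) by [].
transitivity (\int[pushforward leb (-%R : mR -> mR)]_x f x).
  by rewrite ge0_integral_pushforward.
by apply: eq_measure_integral => A mA _; exact: lebesgue_measureN.
Qed.

Lemma ge0_integral_shear1 (s : R) (h : mR * mR -> \bar R) :
  measurable_fun setT h -> (forall w, 0 <= h w) ->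
  \int[leb]_x \int[leb]_y h ((x + s * y)%R, y) =
  \int[leb]_x \int[leb]_y h (x, y).
Proof.
move=> mh h0.
rewrite (fubini_tonelli (fun w : mR * mR => h ((w.1 + s * w.2)%R, w.2)))//=; last first.
  apply: (measurableT_comp mh); apply: measurable_fun_pair => //.
  by apply: measurable_funD => //; apply: measurable_funM.
rewrite (fubini_tonelli h)//; apply: eq_integral => y _.
apply: (@ge0_integral_translate (s * y)%R (fun x => h (x, y))) => //.
exact: measurableT_comp.
Qed.

Lemma ge0_integral_shear2 (s : R) (h : mR * mR -> \bar R) :
  measurable_fun setT h -> (forall w, 0 <= h w) ->
  \int[leb]_x \int[leb]_y h (x, (y + s * x)%R) =
  \int[leb]_x \int[leb]_y h (x, y).
Proof.
move=> mh h0; apply: eq_integral => x _.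
apply: (@ge0_integral_translate (s * x)%R (fun y => h (x, y))) => //.
exact: measurableT_comp.
Qed.

(* A rotation is a product of three shears, which preserve Lebesgue measure by
   Tonelli's theorem and translation invariance. *)
Lemma ge0_integral_rotation (a b : R) (h : mR * mR -> \bar R) :
  (a ^+ 2 + b ^+ 2 = 1)%R ->
  measurable_fun setT h -> (forall w, 0 <= h w) ->
  \int[leb]_x \int[leb]_y h ((a * x + b * y)%R, (- b * x + a * y)%R) =
  \int[leb]_x \int[leb]_y h (x, y).
Proof.
(* The outer shears have coefficient (1 - a) / b; for b = 0 the rotation is the identity or its
   opposite. *)
move=> ab mh h0; have [b0|b0] := eqVneq b 0%R.
  have : ((a - 1) * (a + 1) == 0)%R by apply/eqP; rewrite b0 in ab; lra.
  rewrite mulf_eq0 subr_eq0 addr_eq0 => /orP[] /eqP ->; rewrite b0.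
    apply: eq_integral => x _; apply: eq_integral => y _.
    by congr (h (_, _)); lra.
  transitivity (\int[leb]_x \int[leb]_y h ((- x)%R, (- y)%R)).
    apply: eq_integral => x _; apply: eq_integral => y _.
    by congr (h (_, _)); lra.
  rewrite (@ge0_integral_reflect (fun x => \int[leb]_y h (x, (- y)%R))).
  - apply: eq_integral => x _.
    apply: (@ge0_integral_reflect (fun y => h (x, y))) => //.
    exact: measurableT_comp.
  - pose hN := fun w : mR * mR => h (w.1, (- w.2)%R).
    apply: (measurable_fun_fubini_tonelli_F hN) => [|w]; last exact: h0.
    apply: (measurableT_comp mh); apply: measurable_fun_pair => //.
    exact: measurableT_comp.
  - by move=> x; apply: integral_ge0.
(* For a = cos t and b = sin t this is tan (t / 2), the coefficient of the two outer shears; the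
   middle one has coefficient - b. *)
pose s := ((1 - a) / b)%R.
have sb : (s * b = 1 - a)%R by rewrite /s divfK.
have sa : (s * (1 + a) = b)%R.
  by apply: (mulfI b0); rewrite mulrA [(b * s)%R]mulrC sb; lra.
pose h1 := fun w : mR * mR => h ((w.1 + s * w.2)%R, w.2).
have mh1 : measurable_fun setT h1.
  apply: (measurableT_comp mh); apply: measurable_fun_pair => //.
  by apply: measurable_funD => //; apply: measurable_funM.
pose h2 := fun w : mR * mR => h1 (w.1, (w.2 + (- b) * w.1)%R).
have mh2 : measurable_fun setT h2.
  apply: (measurableT_comp mh1); apply: measurable_fun_pair => //.
  by apply: measurable_funD => //; apply: measurable_funM.
transitivity (\int[leb]_x \int[leb]_y h2 ((x + s * y)%R, y)).
  apply: eq_integral => x _; apply: eq_integral => y _.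
  rewrite /h2 /h1/=; congr (h (_, _)); first last.
    rewrite (_ : y + - b * (x + s * y) = - b * x + (1 - s * b) * y)%R; last by ring.
    by rewrite sb; lra.
  have -> : (x + s * y + s * (y + - b * (x + s * y)) =
    (1 - s * b) * x + (s * (2 - s * b)) * y)%R by ring.
  by rewrite sb (_ : 2 - (1 - a) = 1 + a)%R ?sa; lra.
rewrite ge0_integral_shear1//; last by move=> w; exact: h0.
rewrite /h2 (ge0_integral_shear2 (- b) mh1)//; last by move=> w; exact: h0.
by rewrite /h1 (ge0_integral_shear1 s mh).
Qed.

Lemma measurable_lincomb (a b : R) :
  measurable_fun setT (fun w : mR * mR => a * w.1 + b * w.2 : mR)%R.
Proof. by apply: measurable_funD; apply: measurable_funM. Qed.

Lemma normal_pdf_rotation (a b x y : R) : (a ^+ 2 + b ^+ 2 = 1)%R ->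
  (pdf (a * x + b * y) * pdf (- b * x + a * y) = pdf x * pdf y)%R.
Proof.
move=> ab; rewrite /normal_pdf oner_eq0 /normal_fun.
rewrite mulrACA -expRD [RHS]mulrACA -expRD; congr (_ * expR _)%R.
rewrite -!mulrDl !subr0; congr (_ / _)%R.
transitivity (- ((a ^+ 2 + b ^+ 2) * (x ^+ 2 + y ^+ 2)))%R; first by ring.
by rewrite ab; ring.
Qed.

Lemma ge0_integral_stdnormal2 (h : mR * mR -> \bar R) :
  measurable_fun setT h -> (forall w, 0 <= h w) ->
  \int[gam]_x \int[gam]_y h (x, y) =
  \int[leb]_x \int[leb]_y (h (x, y) * (pdf x * pdf y)%:E).
Proof.
move=> mh h0; have mF := measurable_fun_fubini_tonelli_F (m2 := gam) _ mh h0.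
rewrite (ge0_integral_stdnormal mF); last first.
  by move=> x; exact: integral_ge0.
apply: eq_integral => x _.
have mhx : measurable_fun setT (fun y : mR => h (x, y)) by exact: measurableT_comp.
have mpdf : measurable_fun setT (EFin \o pdf : mR -> _).
  by apply/measurable_EFinP; exact: measurable_normal_pdf.
rewrite /fubini_F (ge0_integral_stdnormal mhx) => [|y]; last exact: h0.
rewrite -(@ge0_integralZr _ _ _ leb _ measurableT _ (emeasurable_funM mhx mpdf)).
- by apply: eq_integral => y _; rewrite -muleA -EFinM mulrC.
- by move=> y _; rewrite mule_ge0// lee_fin normal_pdf_ge0.
- by rewrite lee_fin normal_pdf_ge0.
Qed.

Lemma ge0_stdnormal_rotation (a b : R) (h : mR * mR -> \bar R) :
  (a ^+ 2 + b ^+ 2 = 1)%R ->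
  measurable_fun setT h -> (forall w, 0 <= h w) ->
  \int[gam]_x \int[gam]_y h ((a * x + b * y)%R, (- b * x + a * y)%R) =
  \int[gam]_x \int[gam]_y h (x, y).
Proof.
move=> ab mh h0.
pose hr := fun w : mR * mR => h ((a * w.1 + b * w.2)%R, (- b * w.1 + a * w.2)%R).
have mhr : measurable_fun setT hr.
  apply: (measurableT_comp mh).
  by apply: measurable_fun_pair; exact: measurable_lincomb.
rewrite (ge0_integral_stdnormal2 mhr (fun=> h0 _)).
rewrite (ge0_integral_stdnormal2 mh h0).
(* The density is rotation invariant, so it can be absorbed into the integrand. *)
pose hp := fun w : mR * mR => h w * (pdf w.1 * pdf w.2)%:E.
have mhp : measurable_fun setT hp.
  apply: emeasurable_funM => //; apply/measurable_EFinP.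
  by apply: measurable_funM; apply: (measurableT_comp (@measurable_normal_pdf R 0 1)).
have hp0 w : 0 <= hp w.
  by rewrite mule_ge0// lee_fin mulr_ge0// normal_pdf_ge0.
rewrite -[RHS](ge0_integral_rotation ab mhp hp0).
apply: eq_integral => x _; apply: eq_integral => y _.
by rewrite /hp/= normal_pdf_rotation.
Qed.

(** The first coordinate of the rotation by (p / e, q / e), scaled by e, is p y + q z. The sign of e
    is free, which later yields the symmetry of the Gaussian. *)
Lemma ge0_stdnormal_convolution (p q e : R) (k : mR -> \bar R) :
  (p ^+ 2 + q ^+ 2 = e ^+ 2)%R ->
  measurable_fun setT k -> (forall x, 0 <= k x) ->
  \int[gam]_y \int[gam]_z k (p * y + q * z)%R = \int[gam]_y k (e * y)%R.
Proof.
move=> pqe mk k0; have [e0|e0] := eqVneq e 0%R.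
  have pq0 : (p ^+ 2 + q ^+ 2 == 0)%R by rewrite pqe e0 expr0n.
  rewrite paddr_eq0 ?sqr_ge0// !sqrf_eq0 in pq0.
  have /andP[/eqP-> /eqP->] := pq0.
  apply: eq_integral => y _; rewrite e0 mul0r.
  transitivity (\int[gam]_z cst (k 0%R) z).
    by apply: eq_integral => z _; rewrite !mul0r addr0.
  by rewrite integral_cst//= probability_setT mule1.
pose h := fun w : mR * mR => k (e * w.1)%R.
have mh : measurable_fun setT h.
  by apply: (measurableT_comp mk); apply: measurable_funM.
transitivity (\int[gam]_y \int[gam]_z
    h ((p / e * y + q / e * z)%R, (- (q / e) * y + p / e * z)%R)).
  apply: eq_integral => y _; apply: eq_integral => z _.
  by rewrite /h/=; congr k; field.
rewrite (@ge0_stdnormal_rotation (p / e) (q / e) h _ mh (fun=> k0 _)); last first.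
  by rewrite !expr_div_n -mulrDl pqe divff// expf_eq0.
apply: eq_integral => y _.
transitivity (\int[gam]_z cst (k (e * y)%R) z) => //.
by rewrite integral_cst//= probability_setT mule1.
Qed.

Lemma ge0_integral_binormal (rho : R) (h : mR * mR -> \bar R) :
  measurable_fun setT h -> (forall w, 0 <= h w) ->
  \int[binormal rho]_w h w =
  \int[gam]_x \int[gam]_y h (x, (rho * x + Num.sqrt (1 - rho ^+ 2) * y)%R).
Proof.
move=> mh h0; have mhc : measurable_fun setT (h \o correlate rho).
  by apply: measurableT_comp => //; exact: measurable_correlate.
rewrite (ge0_integral_distribution _ mh h0).
by rewrite (fubini_tonelli1 _ mhc (fun=> h0 _)).
Qed.

(** Moves the third variable outermost, so that a rotation can act on the first two while it is
    fixed. *)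
Lemma ge0_stdnormal_rotate_integrals (K : (mR * mR) * mR -> \bar R) :
  measurable_fun setT K -> (forall w, 0 <= K w) ->
  \int[gam]_x \int[gam]_y \int[gam]_z K ((x, y), z) =
  \int[gam]_z \int[gam]_x \int[gam]_y K ((x, y), z).
Proof.
move=> mK K0.
have mF := @measurable_fun_fubini_tonelli_F _ _ _ _ _ gam _ mK K0.
rewrite -(fubini_tonelli1 _ mF) => [|w]; last exact: integral_ge0.
pose P2 : probability (mR * mR)%type R := (gam \x gam)%E.
transitivity (\int[gam]_z \int[P2]_w K (w, z)).
  exact: (@fubini_tonelli _ _ _ _ _ P2 gam K mK K0).
apply: eq_integral => z _.
have mKz : measurable_fun setT (fun w : mR * mR => K (w, z)).
  exact: measurableT_comp.
by rewrite (fubini_tonelli1 _ mKz (fun=> K0 _)).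
Qed.

(** With w = (v, rho v + r z), the rotation x = a u + b v, y = - b u + a v turns the pair into (x,
    tau x + p y + q z). The noise p y + q z has variance 1 - tau^2 and is replaced by a single
    Gaussian. *)
Lemma ge0_binormal_shift (a b rho : R) (h : mR * mR -> \bar R) :
  (a ^+ 2 + b ^+ 2 = 1)%R -> (-1 <= rho <= 1)%R ->
  measurable_fun setT h -> (forall w, 0 <= h w) ->
  \int[gam]_u \int[binormal rho]_w h ((a * u + b * w.1)%R, (a * u + b * w.2)%R) =
  \int[binormal (a ^+ 2 + b ^+ 2 * rho)]_w h w.
Proof.
move=> ab rho1 mh h0.
set tau := (a ^+ 2 + b ^+ 2 * rho)%R; set r := Num.sqrt (1 - rho ^+ 2).
have r2 : (r ^+ 2 = 1 - rho ^+ 2)%R by rewrite sqr_sqrtr//; nra.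
have tau1 : (-1 <= tau <= 1)%R.
  have a2 := sqr_ge0 a; have b2 := sqr_ge0 b; rewrite /tau; nra.
set e := Num.sqrt (1 - tau ^+ 2).
have e2 : (e ^+ 2 = 1 - tau ^+ 2)%R by rewrite sqr_sqrtr//; nra.
(* Coefficients of y and z after substituting u = a x - b y and v = b x + a y into a u + b (rho v +
   r z). *)
pose p := (a * b * (rho - 1))%R; pose q := (b * r)%R.
have pqe : (p ^+ 2 + q ^+ 2 = e ^+ 2)%R.
  rewrite e2 /p /q.
  transitivity (a ^+ 2 * b ^+ 2 * (rho - 1) ^+ 2 + b ^+ 2 * r ^+ 2)%R; first by ring.
  rewrite r2 /tau (_ : a ^+ 2 = 1 - b ^+ 2)%R; first by ring.
  by lra.
pose g z := fun w : mR * mR => h (w.1, (tau * w.1 + p * w.2 + q * z)%R).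
have mg z : measurable_fun setT (g z).
  apply: (measurableT_comp mh); apply: measurable_fun_pair => //.
  by apply: measurable_funD => //; exact: measurable_lincomb.
rewrite [RHS]ge0_integral_binormal//.
transitivity (\int[gam]_u \int[gam]_v \int[gam]_z
    h ((a * u + b * v)%R, (a * u + b * (rho * v + r * z))%R)).
  apply: eq_integral => u _; rewrite ge0_integral_binormal//.
  apply: (measurableT_comp mh); apply: measurable_fun_pair.
    by apply: measurable_funD => //; apply: measurable_funM.
  by apply: measurable_funD => //; apply: measurable_funM.
pose K := fun w : (mR * mR) * mR =>
  h ((a * w.1.1 + b * w.1.2)%R, (a * w.1.1 + b * (rho * w.1.2 + r * w.2))%R).
have mK : measurable_fun setT K.
  apply: (measurableT_comp mh); apply: measurable_fun_pair.
    apply: measurable_funD; apply: measurable_funM => //.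
      exact: (measurableT_comp measurable_fst).
    exact: (measurableT_comp measurable_snd).
  apply: measurable_funD; apply: measurable_funM => //.
    exact: (measurableT_comp measurable_fst).
  apply: measurable_funD; apply: measurable_funM => //.
  exact: (measurableT_comp measurable_snd).
rewrite (ge0_stdnormal_rotate_integrals mK (fun=> h0 _)).
pose L := fun w : (mR * mR) * mR => g w.2 w.1.
have mL : measurable_fun setT L.
  apply: (measurableT_comp mh); apply: measurable_fun_pair.
    exact: (measurableT_comp measurable_fst).
  apply: measurable_funD; last by apply: measurable_funM.
  exact: (measurableT_comp (measurable_lincomb tau p)).
transitivity (\int[gam]_z \int[gam]_x \int[gam]_y L ((x, y), z)).
  apply: eq_integral => z _.
  rewrite -(ge0_stdnormal_rotation ab (mg z) (fun=> h0 _)).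
  apply: eq_integral => x _; apply: eq_integral => y _.
  rewrite /K /g/=; congr (h (_, _)); rewrite /p /q /tau.
  have a2 : (a ^+ 2 = 1 - b ^+ 2)%R by lra.
  transitivity (a * x * (a ^+ 2 + b ^+ 2) +
    b * (rho * y * (a ^+ 2 + b ^+ 2) + r * z))%R.
    by rewrite ab; ring.
  ring: ab.
rewrite -(ge0_stdnormal_rotate_integrals mL (fun=> h0 _)).
apply: eq_integral => x _.
pose k := fun t : mR => h (x, (tau * x + t)%R).
have mk : measurable_fun setT k.
  apply: (measurableT_comp mh); apply: measurable_fun_pair => //.
  exact: measurable_funD.
rewrite -(ge0_stdnormal_convolution pqe mk (fun=> h0 _)).
apply: eq_integral => y _; apply: eq_integral => z _.
by rewrite /L /g /k/= addrA.
Qed.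

End gaussian_pairs.

(** * Integrals of bounded functions *)
Section bounded_measurable.
Context {R : realType}.

(** This class is integrable for every probability and stable under sums, products, sections and
    partial integrals, which makes all linear manipulations free of side conditions. The unbounded
    scores are reached later by truncation. *)
Definition bounded_measurable d (T : measurableType d) (f : T -> R) : Prop :=
  measurable_fun setT f /\ exists C : R, forall x, `|f x| <= C.

Section closure.
Context d (T : measurableType d).
Implicit Types f g : T -> R.

Lemma bounded_measurable_cst (r : R) : bounded_measurable (fun _ : T => r).
Proof. by split => //; exists `|r|. Qed.

Lemma bounded_measurableD f g : bounded_measurable f -> bounded_measurable g ->
  bounded_measurable (fun x => f x + g x).
Proof.
move=> [mf [C fC]] [mg [D gD]]; split; first exact: measurable_funD.
by exists (C + D) => x; rewrite (le_trans (ler_normD _ _))// lerD.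
Qed.

Lemma bounded_measurableM f g : bounded_measurable f -> bounded_measurable g ->
  bounded_measurable (fun x => f x * g x).
Proof.
move=> [mf [C fC]] [mg [D gD]]; split; first exact: measurable_funM.
by exists (C * D) => x; rewrite normrM ler_pM.
Qed.

Lemma bounded_measurableB f g : bounded_measurable f -> bounded_measurable g ->
  bounded_measurable (fun x => f x - g x).
Proof.
move=> [mf [C fC]] [mg [D gD]]; split; first exact: measurable_funB.
by exists (C + D) => x; rewrite (le_trans (ler_normB _ _))// lerD.
Qed.

Lemma bounded_measurable_comp d' (T' : measurableType d') (u : T' -> T) f :
  measurable_fun setT u -> bounded_measurable f ->
  bounded_measurable (fun x => f (u x)).
Proof.
by move=> mu [mf [C fC]]; split; [exact: (measurableT_comp mf)|exists C].
Qed.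

End closure.

Section integral.
Context d (T : measurableType d) (P : probability T R).
Implicit Types f g : T -> R.

Lemma bounded_measurable_integrable f : bounded_measurable f ->
  P.-integrable setT (EFin \o f).
Proof.
move=> [mf [C fC]]; apply: measurable_bounded_integrable => //.
  exact: le_lt_trans (probability_le1 P measurableT) (ltry _).
by exists C; split; [exact: num_real|move=> x Cx y _; exact: le_trans (ltW Cx)].
Qed.

Lemma bounded_integral_EFin f : bounded_measurable f ->
  (\int[P]_x (f x)%:E)%E = (\int[P]_x f x)%:E.
Proof.
move=> bf; rewrite /Rintegral fineK//.
by apply: integrable_fin_num => //; exact: bounded_measurable_integrable.
Qed.

Lemma probability_Rintegral_cst (r : R) : \int[P]_x r = r.
Proof. by rewrite Rintegral_cst//= probability_setT mulr1. Qed.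

Lemma bounded_integralD f g : bounded_measurable f -> bounded_measurable g ->
  \int[P]_x (f x + g x) = \int[P]_x f x + \int[P]_x g x.
Proof. by move=> bf bg; rewrite RintegralD//; exact: bounded_measurable_integrable. Qed.

Lemma bounded_integralB f g : bounded_measurable f -> bounded_measurable g ->
  \int[P]_x (f x - g x) = \int[P]_x f x - \int[P]_x g x.
Proof. by move=> bf bg; rewrite RintegralB//; exact: bounded_measurable_integrable. Qed.

Lemma bounded_integralZ (r : R) f : bounded_measurable f ->
  \int[P]_x (r * f x) = r * \int[P]_x f x.
Proof. by move=> bf; rewrite RintegralZl//; exact: bounded_measurable_integrable. Qed.

Lemma bounded_integral_le f g : bounded_measurable f -> bounded_measurable g ->
  (forall x, f x <= g x) -> \int[P]_x f x <= \int[P]_x g x.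
Proof.
move=> bf bg fg; apply: le_Rintegral => //; exact: bounded_measurable_integrable.
Qed.

End integral.

Section product.
Context d1 d2 (T1 : measurableType d1) (T2 : measurableType d2).
Variables (P1 : probability T1 R) (P2 : probability T2 R).
Variable f : T1 * T2 -> R.
Hypothesis bf : bounded_measurable f.

Lemma bounded_measurable_section (x : T1) :
  bounded_measurable (fun y => f (x, y)).
Proof. exact: (bounded_measurable_comp (measurable_pair1 x)). Qed.

Lemma bounded_measurable_integral :
  bounded_measurable (fun x => \int[P2]_y f (x, y)).
Proof.
have [mf [C fC]] := bf; split.
  apply/measurable_EFinP; rewrite (_ : EFin \o _ = fubini_F P2 (EFin \o f)).
    apply: (@measurable_fubini_F _ _ _ _ _ P1).
    exact: (bounded_measurable_integrable (P1 \x P2)%E bf).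
  apply/funext => x /=; rewrite -bounded_integral_EFin//.
  exact: bounded_measurable_section.
exists C => x.
have ifx := bounded_measurable_integrable P2 (bounded_measurable_section x).
apply: (le_trans (le_normr_Rintegral measurableT ifx)).
rewrite -[leRHS](probability_Rintegral_cst P2); apply: bounded_integral_le => //.
  have [ms [D sD]] := bounded_measurable_section x.
  by split; [exact: measurableT_comp|exists D => y; rewrite normr_id].
exact: bounded_measurable_cst.
Qed.

Lemma bounded_Fubini :
  \int[(P1 \x P2)%E]_w f w = \int[P1]_x \int[P2]_y f (x, y).
Proof.
rewrite {1}/Rintegral -integral12_prod_meas1; last first.
  exact: (bounded_measurable_integrable (P1 \x P2)%E bf).
congr fine; apply: eq_integral => x _.
by rewrite -bounded_integral_EFin//; exact: bounded_measurable_section.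
Qed.

End product.

(* Identities between laws proved by Tonelli's theorem for nonnegative functions
   carry over to bounded ones by adding a constant. *)
Lemma bounded_integral_transfer d d' (T : measurableType d)
    (T' : measurableType d') (P : probability T R) (Q : probability T' R)
    (u : T -> T') (f : T' -> R) :
  measurable_fun setT u ->
  (forall h : T' -> \bar R, measurable_fun setT h -> (forall y, 0 <= h y)%E ->
    (\int[P]_x h (u x) = \int[Q]_y h y)%E) ->
  bounded_measurable f -> \int[P]_x f (u x) = \int[Q]_y f y.
Proof.
move=> mu PQ bf; have [mf [C fC]] := bf.
have bfu := bounded_measurable_comp mu bf.
have bC := bounded_measurable_cst T C; have bC' := bounded_measurable_cst T' C.
have := PQ (fun y => (f y + C)%:E).
rewrite (bounded_integral_EFin P (bounded_measurableD bfu bC)).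
rewrite (bounded_integral_EFin Q (bounded_measurableD bf bC')).
rewrite (bounded_integralD P bfu bC) (bounded_integralD Q bf bC').
rewrite !probability_Rintegral_cst => h.
apply: (addIr C); apply: EFin_inj; apply: h.
  by apply/measurable_EFinP; exact: measurable_funD.
by move=> y; rewrite lee_fin; have := fC y; rewrite ler_norml; lra.
Qed.

End bounded_measurable.

(** * Noise stability of square-integrable functions *)
Section gaussian_correlation.
Context {R : realType}.
Local Notation mR := (measurableTypeR R).
Local Notation gam := (@stdnormal R).
Implicit Types (k : mR -> R) (rho : R).

(** For [rho] in [-1, 1], the quadratic form of the Ornstein-Uhlenbeck (Mehler) operator, known as
    noise stability. *)
Definition gaussian_correlation k rho : R :=
  \int[binormal rho]_w (k w.1 * k w.2).
Local Notation corr := gaussian_correlation.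

Lemma bounded_measurable_pair k l : bounded_measurable k -> bounded_measurable l ->
  bounded_measurable (fun w : mR * mR => k w.1 * l w.2).
Proof.
by move=> bk bl; apply: bounded_measurableM; apply: bounded_measurable_comp.
Qed.

Lemma measurable_shift (a b : R) : measurable_fun setT
  (fun w : mR * (mR * mR) => (a * w.1 + b * w.2.1, a * w.1 + b * w.2.2) : mR * mR).
Proof.
apply: measurable_fun_pair; apply: measurable_funD; apply: measurable_funM => //.
  exact: (measurableT_comp measurable_fst).
exact: (measurableT_comp measurable_snd).
Qed.

Lemma ge0_stdnormal_opp (k : mR -> \bar R) :
  measurable_fun setT k -> (forall x, 0 <= k x)%E ->
  (\int[gam]_y k (- y)%R = \int[gam]_y k y)%E.
Proof.
move=> mk k0.
have h (e e' : R) : e ^+ 2 + 0 ^+ 2 = e' ^+ 2 ->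
    (\int[gam]_y \int[gam]_z k (e * y + 0 * z)%R = \int[gam]_y k (e' * y)%R)%E.
  by move=> ee'; exact: ge0_stdnormal_convolution.
(* The same double integral is evaluated with e' = 1 and with e' = - 1. *)
have h1 := h (-1) 1; have h2 := h (-1) (-1).
rewrite expr0n addr0 sqrrN in h1 h2.
transitivity (\int[gam]_y k (-1 * y)%R)%E.
  by apply: eq_integral => y _; rewrite mulN1r.
rewrite -h2// h1//.
by apply: eq_integral => y _; rewrite mul1r.
Qed.

Section laws.
Variable h : mR * mR -> \bar R.
Hypotheses (mh : measurable_fun setT h) (h0 : (forall w, 0 <= h w)%E).

(** The sign is absorbed by the noise: - (rho x + r y) = - rho x + r (- y), and y is symmetric. *)
Lemma ge0_binormal_opp2 rho :
  (\int[binormal rho]_w h (w.1, (- w.2)%R) = \int[binormal (- rho)%R]_w h w)%E.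
Proof.
pose g := fun w : mR * mR => h (w.1, (- w.2)%R).
have mg : measurable_fun setT g.
  apply: (measurableT_comp mh); apply: measurable_fun_pair => //.
  exact: measurableT_comp.
have g0 w : (0 <= g w)%E by exact: h0.
apply: (etrans (ge0_integral_binormal rho mg g0)).
apply: (etrans _ (esym (ge0_integral_binormal (- rho) mh h0))).
rewrite sqrrN.
apply: eq_integral => x _ /=.
set r := Num.sqrt _.
pose k := fun y : mR => h (x, (- rho * x + r * y)%R).
have mk : measurable_fun setT k.
  apply: (measurableT_comp mh); apply: measurable_fun_pair => //.
  by apply: measurable_funD => //; apply: measurable_funM.
rewrite -[RHS](ge0_stdnormal_opp mk (fun=> h0 _)).
by apply: eq_integral => y _; rewrite /k /g/= opprD mulNr mulrN.
Qed.

(** Here the symmetric variable is x, in the outer integral. *)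
Lemma ge0_binormal_opp1 rho :
  (\int[binormal rho]_w h ((- w.1)%R, w.2) = \int[binormal (- rho)%R]_w h w)%E.
Proof.
pose g := fun w : mR * mR => h ((- w.1)%R, w.2).
have mg : measurable_fun setT g.
  apply: (measurableT_comp mh); apply: measurable_fun_pair => //.
  exact: measurableT_comp.
have g0 w : (0 <= g w)%E by exact: h0.
apply: (etrans (ge0_integral_binormal rho mg g0)).
apply: (etrans _ (esym (ge0_integral_binormal (- rho) mh h0))).
rewrite sqrrN.
set r := Num.sqrt _.
pose k := fun w : mR * mR => h (w.1, (- rho * w.1 + r * w.2)%R).
have mk : measurable_fun setT k.
  apply: (measurableT_comp mh); apply: measurable_fun_pair => //.
  exact: measurable_lincomb.
have mF := @measurable_fun_fubini_tonelli_F _ _ _ _ _ gam k mk (fun=> h0 _).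
rewrite -[RHS](ge0_stdnormal_opp mF) => [|x]; last first.
  by apply: integral_ge0 => y _; exact: h0.
apply: eq_integral => x _; apply: eq_integral => y _ /=.
by rewrite /k /g/= mulrNN.
Qed.

End laws.

Lemma ge0_binormal_snd rho (k : mR -> \bar R) : -1 <= rho <= 1 ->
  measurable_fun setT k -> (forall x, 0 <= k x)%E ->
  (\int[binormal rho]_w k w.2 = \int[gam]_y k y)%E.
Proof.
move=> rho1 mk k0.
have mk2 : measurable_fun setT (fun w : mR * mR => k w.2) by exact: measurableT_comp.
apply: (etrans (ge0_integral_binormal rho mk2 (fun=> k0 _))).
rewrite (@ge0_stdnormal_convolution _ rho (Num.sqrt (1 - rho ^+ 2)) 1)//.
  by apply: eq_integral => y _; rewrite mul1r.
by rewrite sqr_sqrtr ?expr1n; nra.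
Qed.

Lemma ge0_binormal_fst rho (k : mR -> \bar R) :
  measurable_fun setT k -> (forall x, 0 <= k x)%E ->
  (\int[binormal rho]_w k w.1 = \int[gam]_y k y)%E.
Proof.
move=> mk k0.
have mk1 : measurable_fun setT (fun w : mR * mR => k w.1) by exact: measurableT_comp.
apply: (etrans (ge0_integral_binormal rho mk1 (fun=> k0 _))).
apply: eq_integral => x _; transitivity (\int[gam]_y cst (k x) y)%E => //.
by rewrite integral_cst//= probability_setT mule1.
Qed.

Lemma ge0_binormal1 (h : mR * mR -> \bar R) :
  measurable_fun setT h -> (forall w, 0 <= h w)%E ->
  (\int[binormal 1]_w h w = \int[gam]_x h (x, x))%E.
Proof.
move=> mh h0; apply: (etrans (ge0_integral_binormal 1 mh h0)).
apply: eq_integral => x _; transitivity (\int[gam]_y cst (h (x, x)) y)%E.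
  by apply: eq_integral => y _; rewrite expr1n subrr sqrtr0 mul0r addr0 mul1r.
by rewrite integral_cst//= probability_setT mule1.
Qed.

Lemma bounded_binormal_fst rho k : bounded_measurable k ->
  \int[binormal rho]_w k w.1 = \int[gam]_x k x.
Proof.
by apply: bounded_integral_transfer => // h mh h0; exact: ge0_binormal_fst.
Qed.

Lemma bounded_binormal_snd rho k : -1 <= rho <= 1 -> bounded_measurable k ->
  \int[binormal rho]_w k w.2 = \int[gam]_x k x.
Proof.
move=> rho1; apply: bounded_integral_transfer => // h mh h0.
exact: ge0_binormal_snd.
Qed.

Lemma gaussian_correlation0 k : bounded_measurable k ->
  corr k 0 = (\int[gam]_x k x) ^+ 2.
Proof.
move=> bk; have bkk := bounded_measurable_pair bk bk.
transitivity (\int[(gam \x gam)%E]_w (k w.1 * k w.2)).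
  pose P2 : probability (mR * mR)%type R := (gam \x gam)%E.
  suff tr (h : mR * mR -> \bar R) : measurable_fun setT h ->
      (forall w, 0 <= h w)%E ->
      (\int[P2]_w h w = \int[binormal 0]_w h w)%E.
    apply/esym.
    exact: (@bounded_integral_transfer R _ _ _ _ P2 (binormal 0) id _ _ tr bkk).
  move=> mh h0.
  apply: (etrans (fubini_tonelli1 _ mh h0)).
  apply: (etrans _ (esym (ge0_integral_binormal 0 mh h0))).
  apply: eq_integral => x _; apply: eq_integral => y _.
  by rewrite expr0n/= subr0 sqrtr1 mul1r mul0r add0r.
rewrite (bounded_Fubini gam gam bkk).
transitivity (\int[gam]_x ((\int[gam]_y k y) * k x)).
  by apply: eq_Rintegral => x _; rewrite /= (bounded_integralZ gam (k x) bk) mulrC.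
by rewrite (bounded_integralZ gam _ bk) -expr2.
Qed.

(** Conditioning on the shared part u: inequalities around correlation a^2 for k follow from
    inequalities around 0 for its slices. *)
Lemma gaussian_correlation_shift (a b rho : R) k : a ^+ 2 + b ^+ 2 = 1 ->
  -1 <= rho <= 1 -> bounded_measurable k ->
  corr k (a ^+ 2 + b ^+ 2 * rho) =
  \int[gam]_u corr (fun v => k (a * u + b * v)) rho.
Proof.
move=> ab rho1 bk; have bkk := bounded_measurable_pair bk bk.
pose P : probability (mR * (mR * mR))%type R := (gam \x binormal rho)%E.
have ms := measurable_shift a b.
have tr (h : mR * mR -> \bar R) : measurable_fun setT h ->
    (forall w, 0 <= h w)%E ->
    (\int[P]_w h (a * w.1 + b * w.2.1, a * w.1 + b * w.2.2)%R =
     \int[binormal (a ^+ 2 + b ^+ 2 * rho)]_w h w)%E.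
  move=> mh h0; apply: (etrans _ (ge0_binormal_shift ab rho1 mh h0)).
  exact: (fubini_tonelli1 _ (measurableT_comp mh ms) (fun=> h0 _)).
apply: (etrans (esym (bounded_integral_transfer ms tr bkk))).
exact: (bounded_Fubini gam (binormal rho) (bounded_measurable_comp ms bkk)).
Qed.

End gaussian_correlation.

(** * Noise stability of bounded functions of one Gaussian *)

Section gaussian_noise_stability.
Context {R : realType}.
Local Notation mR := (measurableTypeR R).
Local Notation gam := (@stdnormal R).
Local Notation corr := (@gaussian_correlation R).
Implicit Types (k : mR -> R) (rho : R).

Lemma bounded_measurable_slice (a b u : R) k : bounded_measurable k ->
  bounded_measurable (fun v : mR => k (a * u + b * v)).
Proof.
apply: bounded_measurable_comp.
by apply: measurable_funD => //; apply: measurable_funM.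
Qed.

(* X and Y can be written a u + b v and a u + b v' with v, v' independent, so
   that conditionally on u the expectation is a square. *)
Lemma gaussian_correlation_ge0 k rho : 0 <= rho <= 1 -> bounded_measurable k ->
  0 <= corr k rho.
Proof.
move=> rho1 bk; pose a := Num.sqrt rho; pose b := Num.sqrt (1 - rho).
have a2 : a ^+ 2 = rho by rewrite sqr_sqrtr//; lra.
have b2 : b ^+ 2 = 1 - rho by rewrite sqr_sqrtr//; lra.
have -> : rho = a ^+ 2 + b ^+ 2 * 0 by lra.
rewrite gaussian_correlation_shift//; [|lra..].
apply: Rintegral_ge0 => u _.
by rewrite gaussian_correlation0 ?sqr_ge0//; exact: bounded_measurable_slice.
Qed.

Lemma gaussian_correlation_center k rho (m := \int[gam]_x k x) :
  -1 <= rho <= 1 -> bounded_measurable k ->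
  corr (fun x => k x - m) rho = corr k rho - m ^+ 2.
Proof.
move=> rho1 bk; have bkk := bounded_measurable_pair bk bk.
have bk1 : bounded_measurable (fun w : mR * mR => k w.1).
  exact: bounded_measurable_comp.
have bk2 : bounded_measurable (fun w : mR * mR => k w.2).
  exact: bounded_measurable_comp.
have bc (r : R) : bounded_measurable (fun w : mR * mR => r).
  exact: bounded_measurable_cst.
transitivity (\int[binormal rho]_w
    (k w.1 * k w.2 - m * (k w.1 + k w.2) + m ^+ 2)).
  by apply: eq_Rintegral => w _; ring.
have bs := bounded_measurableD bk1 bk2.
have bms := bounded_measurableM (bc m) bs.
rewrite (bounded_integralD _ (bounded_measurableB bkk bms) (bc _)).
rewrite (bounded_integralB _ bkk bms) (bounded_integralZ _ m bs).
rewrite (bounded_integralD _ bk1 bk2) probability_Rintegral_cst.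
rewrite (bounded_binormal_fst rho bk) (bounded_binormal_snd rho1 bk) -/m.
by rewrite /gaussian_correlation; ring.
Qed.

(** [corr k 0] is the squared mean of k, so the difference is the correlation of k minus its mean,
    to which nonnegativity applies. *)
Lemma gaussian_correlation0_le k rho : 0 <= rho <= 1 -> bounded_measurable k ->
  corr k 0 <= corr k rho.
Proof.
move=> rho1 bk; rewrite gaussian_correlation0// -subr_ge0.
rewrite -gaussian_correlation_center//; last by lra.
apply: gaussian_correlation_ge0 => //.
by apply: bounded_measurableB => //; exact: bounded_measurable_cst.
Qed.

Lemma bounded_binormal_opp2 rho (f : mR * mR -> R) : bounded_measurable f ->
  \int[binormal rho]_w f (w.1, - w.2) = \int[binormal (- rho)]_w f w.
Proof.
pose u := fun w : mR * mR => (w.1, - w.2) : mR * mR.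
have mu : measurable_fun setT u.
  by apply: measurable_fun_pair => //; exact: measurableT_comp.
apply: (bounded_integral_transfer mu) => h mh h0.
exact: ge0_binormal_opp2.
Qed.

Lemma bounded_binormal_opp1 rho (f : mR * mR -> R) : bounded_measurable f ->
  \int[binormal rho]_w f (- w.1, w.2) = \int[binormal (- rho)]_w f w.
Proof.
pose u := fun w : mR * mR => (- w.1, w.2) : mR * mR.
have mu : measurable_fun setT u.
  by apply: measurable_fun_pair => //; exact: measurableT_comp.
apply: (bounded_integral_transfer mu) => h mh h0.
exact: ge0_binormal_opp1.
Qed.

(** For s = 1 or - 1 the function is twice the even or the odd part of k. Negating one variable
    flips the correlation; negating both preserves it. *)
Lemma gaussian_correlation_sym (s : R) k rho : s ^+ 2 = 1 ->
  bounded_measurable k ->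
  corr (fun x => k x + s * k (- x)) rho = 2 * (corr k rho + s * corr k (- rho)).
Proof.
move=> s2 bk; have bkk := bounded_measurable_pair bk bk.
have bl : bounded_measurable (fun x : mR => k (- x)).
  exact: bounded_measurable_comp.
have bkl := bounded_measurable_pair bk bl.
have blk := bounded_measurable_pair bl bk.
have bll := bounded_measurable_pair bl bl.
have bc (r : R) : bounded_measurable (fun w : mR * mR => r).
  exact: bounded_measurable_cst.
have bX := bounded_measurableD bkl blk.
have bsX := bounded_measurableM (bc s) bX.
transitivity (\int[binormal rho]_w
    (k w.1 * k w.2 + k (- w.1) * k (- w.2) +
     s * (k w.1 * k (- w.2) + k (- w.1) * k w.2))).
  by apply: eq_Rintegral => w _; ring: s2.
rewrite (bounded_integralD _ (bounded_measurableD bkk bll) bsX).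
rewrite (bounded_integralD _ bkk bll) (bounded_integralZ _ s bX).
rewrite (bounded_integralD _ bkl blk).
have -> : \int[binormal rho]_w (k w.1 * k (- w.2)) = corr k (- rho).
  exact: (bounded_binormal_opp2 rho bkk).
have -> : \int[binormal rho]_w (k (- w.1) * k w.2) = corr k (- rho).
  exact: (bounded_binormal_opp1 rho bkk).
have -> : \int[binormal rho]_w (k (- w.1) * k (- w.2)) = corr k rho.
  rewrite -[in RHS](opprK rho).
  apply: (etrans (bounded_binormal_opp2 rho blk)).
  exact: (bounded_binormal_opp1 (- rho) bkk).
rewrite -/(corr k rho); move: (corr k rho) (corr k (- rho)) => A B.
by ring.
Qed.

(* Nonnegativity applied to the odd part of k, and monotonicity at 0 applied to
   its even part. *)
Lemma gaussian_correlation_opp k rho : 0 <= rho <= 1 -> bounded_measurable k ->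
  corr k (- rho) <= corr k rho /\
  2 * corr k 0 <= corr k rho + corr k (- rho).
Proof.
move=> rho1 bk.
have sqrN1 : (-1 : R) ^+ 2 = 1 by rewrite sqrrN expr1n.
have bsym (s : R) : bounded_measurable (fun x : mR => k x + s * k (- x)).
  apply: bounded_measurableD => //; apply: bounded_measurableM.
    exact: bounded_measurable_cst.
  exact: bounded_measurable_comp.
split.
  have := gaussian_correlation_ge0 rho1 (bsym (-1)).
  rewrite (gaussian_correlation_sym rho sqrN1 bk).
  by move: (corr k rho) (corr k (- rho)) => A B; lra.
have := gaussian_correlation0_le rho1 (bsym 1).
have s1 : (1 : R) ^+ 2 = 1 by rewrite expr1n.
rewrite (gaussian_correlation_sym rho s1 bk) (gaussian_correlation_sym 0 s1 bk).
rewrite oppr0.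
by move: (corr k 0) (corr k rho) (corr k (- rho)) => A B C; lra.
Qed.

Lemma bounded_measurable_correlation_slice (a b rho : R) k :
  bounded_measurable k ->
  bounded_measurable (fun u : mR => corr (fun v => k (a * u + b * v)) rho).
Proof.
move=> bk; have bkk := bounded_measurable_pair bk bk.
exact: (bounded_measurable_integral gam (binormal rho)
  (bounded_measurable_comp (measurable_shift a b) bkk)).
Qed.

(** Taking a^2 = x and rho = t / (1 - x) writes x + t and x - t as a^2 + b^2 rho and a^2 - b^2 rho.
    [gaussian_correlation_opp] applies to each slice, and the result is integrated over u. *)
Lemma gaussian_noise_stability k : bounded_measurable k ->
  noise_stability (corr k).
Proof.
move=> bk.
have key x t : 0 <= x -> 0 <= t -> x + t <= 1 ->
    corr k (x - t) <= corr k (x + t) /\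
    2 * corr k x <= corr k (x + t) + corr k (x - t).
  (* At x = 1 the quotient defining [rho] degenerates, but then t = 0. *)
  move=> x0 t0 xt1; have [x1|x1] := eqVneq x 1.
    have -> : t = 0 by lra.
    rewrite subr0 addr0; split => //.
    by move: (corr k x) => A; lra.
  have {}x1 : x < 1 by rewrite lt_neqAle x1/=; lra.
  pose rho := t / (1 - x).
  have rhoE : (1 - x) * rho = t by rewrite /rho mulrC divfK//; lra.
  have rho1 : 0 <= rho <= 1.
    by rewrite /rho divr_ge0 ?ler_pdivrMr; lra.
  pose a := Num.sqrt x; pose b := Num.sqrt (1 - x).
  have a2 : a ^+ 2 = x by rewrite sqr_sqrtr//; lra.
  have b2 : b ^+ 2 = 1 - x by rewrite sqr_sqrtr//; lra.
  have ab : a ^+ 2 + b ^+ 2 = 1 by lra.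
  pose ku (u v : R) := k (a * u + b * v).
  have bku u : bounded_measurable (ku u : mR -> R) by exact: bounded_measurable_slice.
  have E r : -1 <= r <= 1 -> corr k (x + (1 - x) * r) = \int[gam]_u corr (ku u) r.
    by move=> r1; have := gaussian_correlation_shift ab r1 bk; rewrite a2 b2.
  have bE r := @bounded_measurable_correlation_slice a b r k bk.
  have -> : x - t = x + (1 - x) * (- rho) by lra.
  have -> : x + t = x + (1 - x) * rho by lra.
  have rho1' : -1 <= rho <= 1 by lra.
  have Nrho1 : -1 <= - rho <= 1 by lra.
  have zero1 : -1 <= (0 : R) <= 1 by lra.
  rewrite (E rho rho1') (E (- rho) Nrho1); split.
    apply: bounded_integral_le (bE _) (bE _) _ => u.
    by have [] := gaussian_correlation_opp rho1 (bku u).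
  have -> : corr k x = \int[gam]_u corr (ku u) 0.
    by have := E 0 zero1; rewrite mulr0 addr0.
  rewrite -(bounded_integralZ gam 2 (bE 0)).
  rewrite -(bounded_integralD gam (bE rho) (bE (- rho))).
  apply: bounded_integral_le.
  - exact: (bounded_measurableM (bounded_measurable_cst _ _) (bE _)).
  - exact: (bounded_measurableD (bE _) (bE _)).
  - by move=> u; have [] := gaussian_correlation_opp rho1 (bku u).
split=> [x x1|x t x0 t0 xt|x t x0 t0 xt].
- exact: gaussian_correlation_ge0.
- by have [] := key x t x0 t0 xt.
- by have [] := key x t x0 t0 xt.
Qed.

End gaussian_noise_stability.

(** * Extension to an independent shared variable and to square-integrable functions *)

Section mixture.
Context {R : realType} d (T : measurableType d).
Variable P : probability T R.
Local Notation mR := (measurableTypeR R).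
Local Notation gam := (@stdnormal R).
Implicit Types (f : T * mR -> R) (rho : R).

(** The first variable is common to both factors, like Theta and Z in System B; only the Gaussian
    argument differs. *)
Definition mixture_correlation f rho : R :=
  \int[(P \x binormal rho)%E]_w (f (w.1, w.2.1) * f (w.1, w.2.2)).

Lemma measurable_copy1 :
  measurable_fun setT (fun w : T * (mR * mR) => (w.1, w.2.1)).
Proof.
apply: measurable_fun_pair => //.
exact: (measurableT_comp measurable_fst measurable_snd).
Qed.

Lemma measurable_copy2 :
  measurable_fun setT (fun w : T * (mR * mR) => (w.1, w.2.2)).
Proof.
apply: measurable_fun_pair => //.
exact: (measurableT_comp measurable_snd measurable_snd).
Qed.

(** Conditionally on the shared variable this is a [gaussian_correlation], and the three
    inequalities are linear, so they survive averaging. *)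
Lemma bounded_mixture_noise_stability f : bounded_measurable f ->
  noise_stability (mixture_correlation f).
Proof.
move=> bf.
have bff := bounded_measurableM
  (bounded_measurable_comp measurable_copy1 bf)
  (bounded_measurable_comp measurable_copy2 bf).
pose k t : mR -> R := fun x => f (t, x).
have E rho : mixture_correlation f rho = \int[P]_t gaussian_correlation (k t) rho.
  exact: (bounded_Fubini P (binormal rho) bff).
have bE rho : bounded_measurable (fun t => gaussian_correlation (k t) rho).
  exact: (bounded_measurable_integral P (binormal rho) bff).
have ns t : noise_stability (gaussian_correlation (k t)).
  by apply: gaussian_noise_stability; exact: bounded_measurable_section.
split=> [x x1|x t x0 t0 xt|x t x0 t0 xt].
- by rewrite E; apply: Rintegral_ge0 => s _; have [h _ _] := ns s; exact: h.
- rewrite 2!E; apply: (bounded_integral_le P (bE _) (bE _)) => s.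
  by have [_ h _] := ns s; exact: h.
- rewrite 3!E -(bounded_integralZ P 2 (bE x)).
  rewrite -(bounded_integralD P (bE (x + t)) (bE (x - t))).
  apply: bounded_integral_le.
  + exact: (bounded_measurableM (bounded_measurable_cst _ _) (bE _)).
  + exact: (bounded_measurableD (bE _) (bE _)).
  + by move=> s; have [_ _ h] := ns s; exact: h.
Qed.

(** Weak inequalities pass to pointwise limits; x - t can be as low as - 1, whence the interval of
    convergence. *)
Lemma noise_stability_cvg (Fn : (R -> R)^nat) (F : R -> R) :
  (forall n, noise_stability (Fn n)) ->
  (forall x, -1 <= x <= 1 -> Fn ^~ x @ \oo --> F x) -> noise_stability F.
Proof.
move=> ns cF; split=> [x x1|x t x0 t0 xt|x t x0 t0 xt].
- have cx : Fn ^~ x @ \oo --> F x by apply: cF; lra.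
  apply: (ler_cvg_to (cvg_cst 0) cx).
  by near=> n; have [h _ _] := ns n; exact: h.
- have cm : Fn ^~ (x - t) @ \oo --> F (x - t) by apply: cF; lra.
  have cp : Fn ^~ (x + t) @ \oo --> F (x + t) by apply: cF; lra.
  apply: (ler_cvg_to cm cp).
  by near=> n; have [_ h _] := ns n; exact: h.
- have cx : Fn ^~ x @ \oo --> F x by apply: cF; lra.
  have cm : Fn ^~ (x - t) @ \oo --> F (x - t) by apply: cF; lra.
  have cp : Fn ^~ (x + t) @ \oo --> F (x + t) by apply: cF; lra.
  have c2 : 2 * Fn n x @[n --> \oo] --> 2 * F x by apply: cvgM => //; exact: cvg_cst.
  have cs : Fn n (x + t) + Fn n (x - t) @[n --> \oo] --> F (x + t) + F (x - t).
    exact: cvgD.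
  apply: (ler_cvg_to c2 cs).
  by near=> n; have [_ _ h] := ns n; exact: h.
Unshelve. all: by end_near. Qed.

Definition clip (n : nat) (y : R) : R := Num.max (- n%:R) (Num.min y n%:R).

Lemma normr_clip_le n y : `|clip n y| <= n%:R.
Proof.
have n0 : 0 <= n%:R :> R by [].
rewrite /clip ler_norml; apply/andP; split; first by rewrite le_max lexx.
by rewrite ge_max ge_min lexx orbT andbT; lra.
Qed.

Lemma normr_clip_le_id n y : `|clip n y| <= `|y|.
Proof.
have n0 : 0 <= n%:R :> R by [].
have := ler_norm y; have := ler_norm (- y); rewrite normrN => h1 h2.
have y0 := normr_ge0 y.
rewrite /clip ler_norml; apply/andP; split.
  by rewrite le_max; apply/orP; right; rewrite le_min; apply/andP; split; lra.
rewrite ge_max; apply/andP; split; first by lra.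
by rewrite ge_min h2.
Qed.

Lemma clip_id n y : `|y| <= n%:R -> clip n y = y.
Proof. by rewrite ler_norml => /andP[h1 h2]; rewrite /clip min_l// max_r. Qed.

Lemma clip_cvg y : clip ^~ y @ \oo --> y.
Proof.
apply: cvg_near_cst; near=> n; apply: clip_id; near: n.
exists (Num.truncn `|y|).+1 => // n /= yn.
apply: (le_trans (ltW (truncnS_gt `|y|))).
by rewrite ler_nat.
Unshelve. all: by end_near. Qed.

Lemma measurable_clip n : measurable_fun setT (clip n).
Proof. by apply: measurable_maxr => //; exact: measurable_minr. Qed.

Section square_integrable.
Variable f : T * mR -> R.
Hypotheses (mf : measurable_fun setT f)
  (f2 : (\int[(P \x gam)%E]_w (f w ^+ 2)%:E < +oo)%E).

Let mf1 : measurable_fun setT (fun w : T * (mR * mR) => f (w.1, w.2.1)).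
Proof. exact: (measurableT_comp mf measurable_copy1). Qed.

Let mf2 : measurable_fun setT (fun w : T * (mR * mR) => f (w.1, w.2.2)).
Proof. exact: (measurableT_comp mf measurable_copy2). Qed.

Let msq : measurable_fun setT (fun w => (f w ^+ 2)%:E).
Proof. by apply/measurable_EFinP; exact: measurable_funX. Qed.

Let sq0 w : (0 <= (f w ^+ 2)%:E)%E.
Proof. by rewrite lee_fin sqr_ge0. Qed.

Lemma mixture_square1 rho :
  (\int[(P \x binormal rho)%E]_w (f (w.1, w.2.1) ^+ 2)%:E =
   \int[(P \x gam)%E]_w (f w ^+ 2)%:E)%E.
Proof.
apply: (etrans (fubini_tonelli1 _ (measurableT_comp msq measurable_copy1)
  (fun=> sq0 _))).
apply: (etrans _ (esym (fubini_tonelli1 _ msq sq0))).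
apply: eq_integral => t _.
exact: (ge0_binormal_fst rho (measurableT_comp msq (measurable_pair1 t)) (fun=> sq0 _)).
Qed.

Lemma mixture_square2 rho : -1 <= rho <= 1 ->
  (\int[(P \x binormal rho)%E]_w (f (w.1, w.2.2) ^+ 2)%:E =
   \int[(P \x gam)%E]_w (f w ^+ 2)%:E)%E.
Proof.
move=> rho1.
apply: (etrans (fubini_tonelli1 _ (measurableT_comp msq measurable_copy2)
  (fun=> sq0 _))).
apply: (etrans _ (esym (fubini_tonelli1 _ msq sq0))).
apply: eq_integral => t _.
exact: (ge0_binormal_snd rho1 (measurableT_comp msq (measurable_pair1 t)) (fun=> sq0 _)).
Qed.

(** Majorant of the product and of all its truncations, integrable because both Gaussian arguments
    have standard marginals. *)
Let g (w : T * (mR * mR)) : \bar R :=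
  ((f (w.1, w.2.1) ^+ 2)%:E + (f (w.1, w.2.2) ^+ 2)%:E)%E.

Let ig rho : -1 <= rho <= 1 -> ((P \x binormal rho)%E).-integrable setT g.
Proof.
move=> rho1; apply: integrableD => //; apply/integrableP; split.
- exact: (measurableT_comp msq measurable_copy1).
- under eq_integral do rewrite gee0_abs//.
  by rewrite mixture_square1.
- exact: (measurableT_comp msq measurable_copy2).
- under eq_integral do rewrite gee0_abs//.
  by rewrite mixture_square2.
Qed.

Let prod_le_g (y z u v : R) : `|u| <= `|y| -> `|v| <= `|z| ->
  `|u * v| <= y ^+ 2 + z ^+ 2.
Proof.
move=> uy vz; rewrite normrM -(real_normK (num_real y)) -(real_normK (num_real z)).
have := normr_ge0 u; have := normr_ge0 v.
move: `|u| `|v| `|y| `|z| uy vz => a b c e ac be b0 a0.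
have := sqr_ge0 (c - e); nra.
Qed.

Lemma mixture_integrable rho : -1 <= rho <= 1 ->
  ((P \x binormal rho)%E).-integrable setT
    (fun w => (f (w.1, w.2.1) * f (w.1, w.2.2))%:E).
Proof.
move=> rho1; apply: le_integrable (ig rho1) => //.
  by apply/measurable_EFinP; exact: measurable_funM.
move=> w _; rewrite /g/= lee_fin [leRHS]ger0_norm ?addr_ge0 ?sqr_ge0//.
exact: prod_le_g.
Qed.

Lemma mixture_correlation_EFin rho : -1 <= rho <= 1 ->
  (\int[(P \x binormal rho)%E]_w (f (w.1, w.2.1) * f (w.1, w.2.2))%:E =
   (mixture_correlation f rho)%:E)%E.
Proof.
move=> rho1; rewrite /mixture_correlation /Rintegral fineK//.
by apply: integrable_fin_num => //; exact: mixture_integrable.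
Qed.

Lemma mixture_correlation1 :
  (mixture_correlation f 1)%:E = (\int[(P \x gam)%E]_w (f w ^+ 2)%:E)%E.
Proof.
rewrite -mixture_correlation_EFin; last by lra.
pose h (w : T * (mR * mR)) := (f (w.1, w.2.1) * f (w.1, w.2.2))%:E.
have mh : measurable_fun setT h by apply/measurable_EFinP; exact: measurable_funM.
pose diag (w : T * mR) : T * (mR * mR) := (w.1, (w.2, w.2)).
have mdiag : measurable_fun setT diag.
  by do 2 (apply: measurable_fun_pair => //).
have diagE (H : T * (mR * mR) -> \bar R) : measurable_fun setT H ->
    (forall w, 0 <= H w)%E ->
    (\int[(P \x binormal 1)%E]_w H w = \int[(P \x gam)%E]_w H (diag w))%E.
  move=> mH H0; apply: (etrans (fubini_tonelli1 _ mH H0)).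
  apply: (etrans _ (esym (fubini_tonelli1 _ (measurableT_comp mH mdiag) (fun=> H0 _)))).
  apply: eq_integral => t _.
  exact: (ge0_binormal1 (measurableT_comp mH (measurable_pair1 t)) (fun=> H0 _)).
have hd w : h (diag w) = (f w ^+ 2)%:E by case: w => t x; rewrite /h/= -expr2.
(* The integrand may be negative off the diagonal while [diagE] is for nonnegative functions, hence
   the split into positive and negative parts. *)
rewrite -/(\int[(P \x binormal 1)%E]_w h w)%E integralE.
rewrite (diagE _ (measurable_funepos mh) (funepos_ge0 _)).
rewrite (diagE _ (measurable_funeneg mh) (funeneg_ge0 _)).
transitivity (\int[(P \x gam)%E]_w (f w ^+ 2)%:E - \int[(P \x gam)%E]_w cst 0 w)%E.
  congr (_ - _)%E; apply: eq_integral => w _.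
    by rewrite funeposE hd; apply/max_idPl.
  by rewrite funenegE hd; apply/max_idPr; rewrite leeNl oppe0.
by rewrite integral0 sube0.
Qed.

(** Truncations of f are bounded, and their correlations converge by dominated convergence with
    majorant [g]. *)
Lemma mixture_noise_stability : noise_stability (mixture_correlation f).
Proof.
pose fn n w := clip n (f w).
have bfn n : bounded_measurable (fn n).
  split; first exact: (measurableT_comp (measurable_clip n) mf).
  by exists n%:R => w; exact: normr_clip_le.
apply: (@noise_stability_cvg (fun n => mixture_correlation (fn n))).
  by move=> n; exact: bounded_mixture_noise_stability.
move=> rho rho1; apply: fine_cvg; rewrite -mixture_correlation_EFin//.
have [||||_ _] := @dominated_convergence _ _ _ (P \x binormal rho)%E setT measurableT
  (fun n w => (fn n (w.1, w.2.1) * fn n (w.1, w.2.2))%:E)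
  (fun w => (f (w.1, w.2.1) * f (w.1, w.2.2))%:E) g _ _ _ (ig rho1) _.
- move=> n; apply/measurable_EFinP; apply: measurable_funM.
    exact: (measurableT_comp (measurable_clip n) mf1).
  exact: (measurableT_comp (measurable_clip n) mf2).
- by apply/measurable_EFinP; exact: measurable_funM.
- apply: aeW => w _; apply: cvg_EFin; first by near=> n.
  by apply: cvgM; exact: clip_cvg.
- apply: aeW => w n _; rewrite /g/= lee_fin.
  by apply: prod_le_g; exact: normr_clip_le_id.
- by [].
Unshelve. all: by end_near. Qed.

End square_integrable.
End mixture.

(** * Differentiability of the Moreau envelope *)
Section quadratic_expansion.
Context {R : realType}.
Local Notation mR := (measurableTypeR R).
Variables (f : R -> R) (c : R).
Hypothesis c0 : 0 <= c.
Hypothesis f_convex : forall u v s, 0 <= s <= 1 ->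
  f (s * u + (1 - s) * v) <= s * f u + (1 - s) * f v.
Hypothesis f_semiconcave : forall u v s, 0 <= s <= 1 ->
  s * f u + (1 - s) * f v - c * (s * (1 - s) * (u - v) ^+ 2) <=
  f (s * u + (1 - s) * v).

Let slope x h := (f (x + h) - f x) / h.

Let slopeE x h : h != 0 -> f (x + h) = f x + h * slope x h.
Proof. by move=> h0; rewrite /slope mulrC divfK//; lra. Qed.

(* Convexity makes the slope nondecreasing in h, semiconcavity makes it grow at
   rate at most c. *)
Let slope_pos x a b : 0 < a -> a < b ->
  slope x a <= slope x b <= slope x a + c * (b - a).
Proof.
move=> a0 ab; pose s := a / b.
have sb : s * b = a by rewrite /s divfK//; lra.
have s01 : 0 < s <= 1 by rewrite /s divr_gt0 ?ler_pdivrMr; lra.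
have := @f_convex (x + b) x s; have := @f_semiconcave (x + b) x s.
have -> : s * (x + b) + (1 - s) * x = x + a by rewrite -sb; ring.
have -> : (x + b - x) = b by ring.
rewrite !slopeE; [|lra..]; rewrite -sb => h1 h2.
have {}h1 := h1 ltac:(lra); have {}h2 := h2 ltac:(lra).
have sb0 : 0 < s * b by lra.
apply/andP; split; rewrite -(ler_pM2l sb0).
  by rewrite sb in h2 *; nra.
by nra.
Qed.

Let slope_neg x a b : 0 < a -> 0 < b ->
  slope x (- a) <= slope x b <= slope x (- a) + c * (b + a).
Proof.
(* This weight makes x the barycenter of x - a and x + b. *)
move=> a0 b0; pose s := b / (a + b).
have sab : s * (a + b) = b by rewrite /s divfK//; lra.
have s01 : 0 < s < 1 by rewrite /s divr_gt0 ?ltr_pdivrMr; lra.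
have := @f_convex (x - a) (x + b) s; have := @f_semiconcave (x - a) (x + b) s.
have -> : s * (x - a) + (1 - s) * (x + b) = x by lra.
have -> : (x - a - (x + b)) = - (a + b) by ring.
rewrite !slopeE; [|lra..]; rewrite sqrrN => h1 h2.
have {}h1 := h1 ltac:(lra); have {}h2 := h2 ltac:(lra).
have sa0 : 0 < s * a by rewrite mulr_gt0//; lra.
have sE : (1 - s) * b = s * a by lra.
have sE2 : s * (1 - s) * (a + b) ^+ 2 = s * a * (a + b).
  by rewrite -sE; transitivity ((1 - s) * (s * (a + b)) * (a + b)); [ring|rewrite sab].
rewrite sE2 in h1.
have h1' : s * a * (slope x b - slope x (- a)) <= s * a * (c * (b + a)).
  have : (1 - s) * b * slope x b = s * a * slope x b by rewrite sE.
  by lra.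
have h2' : 0 <= s * a * (slope x b - slope x (- a)).
  have : (1 - s) * b * slope x b = s * a * slope x b by rewrite sE.
  by lra.
rewrite ler_pM2l// in h1'; rewrite pmulr_rge0// in h2'.
by lra.
Qed.

(** L is the infimum of the forward slopes, that is, the right derivative. Forward slopes exceed it
    by at most c |h|, and backward slopes fall short of it by at most c |h|. *)
Lemma quadratic_expansion x : exists L, forall h,
  `|f (x + h) - f x - L * h| <= c * h ^+ 2.
Proof.
pose A := [set slope x h | h in [set h | 0 < h]].
have A0 : A !=set0 by exists (slope x 1); exists 1 => //=.
have lbA a : 0 < a -> lbound A (slope x (- a)).
  by move=> a0 _ [b /= b0 <-]; have /andP[] := slope_neg x a0 b0.
have hlA : has_lbound A by exists (slope x (- 1)); exact: lbA.
pose L := inf A.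
have L1 b : 0 < b -> L <= slope x b by move=> b0; apply: ge_inf => //; exists b.
have L2 b : 0 < b -> slope x b - c * b <= L.
  move=> b0; apply: lb_le_inf => // _ [a /= a0 <-].
  have [ab|ba] := ltP a b; last first.
    have : slope x b <= slope x a.
      have [<-//|ba'] := eqVneq b a.
      have ba2 : b < a by rewrite lt_neqAle ba' ba.
      by have /andP[] := slope_pos x b0 ba2.
    by have := mulr_ge0 c0 (ltW b0); lra.
  by have /andP[_] := slope_pos x a0 ab; have := mulr_ge0 c0 (ltW a0); lra.
have L3 a : 0 < a -> slope x (- a) <= L.
  by move=> a0; apply: lb_le_inf => //; exact: lbA.
have L4 a : 0 < a -> L <= slope x (- a) + c * a.
  move=> a0; rewrite leNgt; apply/negP => h.
  pose d := L - (slope x (- a) + c * a).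
  have d0 : 0 < d by rewrite /d; lra.
  (* A forward step b with c b < d contradicts [slope_neg]; c + 1 keeps the denominator positive
     when c = 0. *)
  pose b := d / (c + 1).
  have c1 : 0 < c + 1 by have := c0; lra.
  have bE : b * (c + 1) = d by rewrite /b divfK// gt_eqF.
  have b0 : 0 < b by rewrite /b divr_gt0.
  have := L1 b b0; have /andP[_] := slope_neg x a0 b0.
  move=> h1 h2; have dL : L = d + (slope x (- a) + c * a) by rewrite /d; lra.
  clearbody b d; lra.
exists L => h; have [h0|h0|->] := ltgtP h 0.
- have h0' : 0 < - h by lra.
  have := L3 _ h0'; have := L4 _ h0'; rewrite opprK slopeE; last by lra.
  move=> h1 h2; rewrite ler_norml; nra.
- have := L1 _ h0; have := L2 _ h0; rewrite slopeE; last by lra.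
  move=> h1 h2; rewrite ler_norml; nra.
- by rewrite addr0 subrr mulr0 subr0 normr0 expr0n mulr0.
Qed.

Let quotient_cvg (x L : R) :
  (forall h, `|f (x + h) - f x - L * h| <= c * h ^+ 2) ->
  h^-1 * (f (h + x) - f x) @[h --> 0^'] --> L.
Proof.
move=> hL; apply/cvgrPdist_le => e e0.
have c1 : 0 < c + 1 by have := c0; lra.
pose d := e / (c + 1).
have dE : d * (c + 1) = e by rewrite /d divfK// gt_eqF.
have d0 : 0 < d by rewrite /d divr_gt0.
exists d => //= h /=; rewrite sub0r normrN => hd h0.
have := hL h; rewrite -[h + x]addrC => hh.
have -> : L - h^-1 * (f (x + h) - f x) = - (h^-1 * (f (x + h) - f x - L * h)).
  by field.
rewrite normrN normrM normfV mulrC ler_pdivrMr ?normr_gt0//.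
apply: (le_trans hh); rewrite -(real_normK (num_real h)).
rewrite expr2 mulrA ler_wpM2r//.
have := ler_wpM2l c0 (ltW hd); lra.
Qed.

(** The expansion gives differentiability, hence continuity; the derivative is the pointwise limit
    of the difference quotients at h = 1 / (n + 1). *)
Lemma measurable_quadratic_expansion :
  measurable_fun setT (f : mR -> R) /\
  measurable_fun setT (f^`()%classic : mR -> R).
Proof.
have mf : measurable_fun setT (f : mR -> R).
  apply: continuous_measurable_fun => x; have [L hL] := quadratic_expansion x.
  apply/differentiable_continuous/derivable1_diffP.
  apply/cvg_ex; exists L.
  rewrite (_ : (fun h => _) = (fun h => h^-1 * (f (h + x) - f x))).
    exact: quotient_cvg.
  by apply/funext => h; rewrite /= [h *: 1]mulr1.
split => //.
pose q (n : nat) (x : mR) : R := n.+1%:R * (f (n.+1%:R^-1 + x) - f x).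
apply: (@measurable_fun_cvg _ _ _ _ q) => [n|x _].
  apply: measurable_funM => //; apply: measurable_funB => //.
  by apply: (measurableT_comp mf); exact: measurable_funD.
have [L hL] := quadratic_expansion x.
have -> : f^`()%classic x = L.
  by apply: cvg_lim => //; exact: quotient_cvg.
have h0 : (harmonic n : R) @[n --> \oo] --> (0 : R)^'.
  move=> A [e /= e0 eA].
  have /cvgrPdist_lt/(_ _ e0) := @cvg_harmonic R.
  by apply: filterS => n /= hn; apply: eA => //=; rewrite gt_eqF.
rewrite (_ : q ^~ x = (fun h => h^-1 * (f (h + x) - f x)) \o harmonic).
  exact: (cvg_comp _ _ h0 (quotient_cvg hL)).
by apply/funext => n; rewrite /q/= invrK.
Qed.

End quadratic_expansion.

(** * Convexity and semiconcavity of the envelope *)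

Section moreau_envelope.
Context {R : realType}.
Local Notation mR := (measurableTypeR R).
Variables (phi : R -> \bar R) (tau : R).
Hypotheses (phi_pcc : proper_closed_convex phi) (phi_min : minimum_at phi 0).
Hypothesis tau0 : 0 < tau.

Let c := (2 * tau)^-1.
Let e (u : R) : R := fine (env phi u tau).

Let c0 : 0 < c.
Proof. by rewrite /c invr_gt0; have := tau0; lra. Qed.

Let phi0_fin : phi 0 \is a fin_num.
Proof.
have [[[x xoo] phiNy] _ _] := phi_pcc.
by rewrite fin_real// phiNy (le_lt_trans (phi_min x) xoo).
Qed.

(** The infimum is at least phi 0, the minimum of phi, and at most the value of the objective at y =
    0, which is finite. *)
Let envE u : env phi u tau = (e u)%:E.
Proof.
rewrite /e fineK// fin_real//; apply/andP; split.
  apply: (@lt_le_trans _ _ (phi 0)).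
    by have [[_ phiNy] _ _] := phi_pcc; exact: phiNy.
  apply: le_ereal_inf_tmp => _ [y _ <-]; apply: (le_trans (phi_min y)).
  by rewrite leeDl// lee_fin mulr_ge0 ?sqr_ge0//; have := c0; rewrite /c; lra.
apply: (@le_lt_trans _ _ (phi 0 + ((2 * tau)^-1 * (u - 0) ^+ 2)%:E)%E).
  by apply: ereal_inf_lbound; exists 0.
by rewrite -(fineK phi0_fin) -EFinD ltry.
Qed.

Let env_le u y r : (phi y <= r%:E)%E -> e u <= r + c * (u - y) ^+ 2.
Proof.
move=> yr; rewrite -lee_fin -envE EFinD.
apply: (@le_trans _ _ (phi y + ((2 * tau)^-1 * (u - y) ^+ 2)%:E)%E).
  by apply: ereal_inf_lbound; exists y.
by rewrite leeD2r.
Qed.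

(** Near-minimizers play the role of the proximal point; the real bound r on phi y keeps later
    computations in R. *)
Let env_approx u eps : 0 < eps ->
  exists y r, (phi y <= r%:E)%E /\ r + c * (u - y) ^+ 2 < e u + eps.
Proof.
move=> eps0; apply: contrapT => h.
have : ((e u + eps)%:E <= env phi u tau)%E.
  apply: le_ereal_inf_tmp => _ [y _ <-].
  rewrite leNgt; apply/negP => hy; apply: h; exists y, (fine (phi y)).
  have yfin : phi y \is a fin_num.
    have [[_ phiNy] _ _] := phi_pcc.
    rewrite fin_real// phiNy/=; move: hy; case: (phi y) => // r _.
    exact: ltry.
  by rewrite fineK// lexx; split => //; rewrite -lte_fin EFinD fineK.
by rewrite envE lee_fin; lra.
Qed.

(** Partial minimization of a jointly convex function: near-minimizers at u and v are combined with
    the same weights. *)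
Let env_convex u v s : 0 <= s <= 1 ->
  e (s * u + (1 - s) * v) <= s * e u + (1 - s) * e v.
Proof.
move=> s01; apply/ler_addgt0Pl => eps eps0.
have [y1 [r1 [p1 h1]]] := env_approx u eps0.
have [y2 [r2 [p2 h2]]] := env_approx v eps0.
have p : (phi (s * y1 + (1 - s) * y2) <= (s * r1 + (1 - s) * r2)%:E)%E.
  have [_ _ cv] := phi_pcc; apply: (le_trans (cv _ _ _ s01)).
  rewrite (EFinD (s * r1)) (EFinM s) (EFinM (1 - s)).
  by apply: leeD; apply: lee_wpmul2l => //; rewrite lee_fin; lra.
apply: (le_trans (env_le _ p)).
have h : (s * u + (1 - s) * v - (s * y1 + (1 - s) * y2)) ^+ 2 <=
    s * (u - y1) ^+ 2 + (1 - s) * (v - y2) ^+ 2.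
  have -> : s * u + (1 - s) * v - (s * y1 + (1 - s) * y2) =
    s * (u - y1) + (1 - s) * (v - y2) by ring.
  have : 0 <= s * (1 - s) * (u - y1 - (v - y2)) ^+ 2.
    by apply: mulr_ge0; [apply: mulr_ge0; lra|exact: sqr_ge0].
  nra.
have := ler_wpM2l (ltW c0) h.
nra.
Qed.

(** For fixed y, the quadratic in u satisfies this with equality, by [E], and an infimum over y
    keeps the inequality; y is a near-minimizer at the combined point. *)
Let env_semiconcave u v s : 0 <= s <= 1 ->
  s * e u + (1 - s) * e v - c * (s * (1 - s) * (u - v) ^+ 2) <=
  e (s * u + (1 - s) * v).
Proof.
move=> s01; apply/ler_addgt0Pl => eps eps0.
have [y [r [p h]]] := env_approx (s * u + (1 - s) * v) eps0.
have h1 := env_le u p; have h2 := env_le v p.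
have h3 := ler_wpM2l (_ : 0 <= s) h1; have h4 := ler_wpM2l (_ : 0 <= 1 - s) h2.
have {}h3 := h3 ltac:(lra); have {}h4 := h4 ltac:(lra).
have E : (s * u + (1 - s) * v - y) ^+ 2 =
  s * (u - y) ^+ 2 + (1 - s) * (v - y) ^+ 2 - s * (1 - s) * (u - v) ^+ 2 by ring.
rewrite E in h; move: h h3 h4; lra.
Qed.

Lemma measurable_denv : measurable_fun setT (fun x : mR => denv phi x tau).
Proof.
by have [] := measurable_quadratic_expansion (ltW c0) env_convex env_semiconcave.
Qed.

End moreau_envelope.

(** * Systems A and B *)
Section scores.
Context {R : realType}.
Local Notation mR := (measurableTypeR R).

Lemma noise_stability_scale (a : R) (F : R -> R) : 0 <= a ->
  noise_stability F -> noise_stability (fun x => a * F x).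
Proof.
move=> a0 [F0 F1 F2]; split=> [x x1|x t x0 t0 xt|x t x0 t0 xt].
- by rewrite mulr_ge0// F0.
- by rewrite ler_wpM2l// F1.
- by rewrite mulrCA -mulrDr ler_wpM2l// F2.
Qed.

Lemma measurable_reg_score (phi : R -> \bar R) (beta nu : R) :
  proper_closed_convex phi -> minimum_at phi 0 -> 0 < nu ->
  measurable_fun setT (fun w : mR * mR => reg_score phi beta nu w.1 w.2).
Proof.
move=> pcc pmin nu0; have tau0 : 0 < nu^-1 by rewrite invr_gt0.
have mb : measurable_fun setT (fun w : mR * mR => beta / nu * w.2).
  by apply: measurable_funM.
apply: measurable_funB => //; apply: measurable_funM => //.
apply: (measurableT_comp (measurable_denv pcc pmin tau0)).
exact: measurable_funD.
Qed.

Lemma measurable_loss_score (ell : R -> R) (alpha kappa : R) :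
  proper_closed_convex (EFin \o ell) -> minimum_at (EFin \o ell) 0 ->
  0 < kappa ->
  measurable_fun setT (fun w : mR * mR => loss_score ell alpha kappa w.1 w.2).
Proof.
move=> pcc pmin kappa0.
apply: (measurableT_comp (measurable_denv pcc pmin kappa0)).
by apply: measurable_funD => //; apply: measurable_funM.
Qed.

Lemma inv_size_itv (M : option nat) : M <> Some 0%N ->
  0 <= @inv_size R M <= 1.
Proof.
case: M => [[|m]|] //= _; last by rewrite lexx ler01.
by rewrite invr_ge0 ler0n/= invf_le1 ?ler1n ?ltr0n.
Qed.

Section systems.
Variables (Ftheta Fz : probability mR R) (ell : R -> R) (phi : R -> \bar R).
Hypotheses (ell_pcc : proper_closed_convex (EFin \o ell))
  (ell_min : minimum_at (EFin \o ell) 0)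
  (phi_pcc : proper_closed_convex phi) (phi_min : minimum_at phi 0).

(** System A is taken with parameters (gamma, 1), so that one pair F, G serves every (delta, c) with
    c delta = gamma. Its first two equations give F 1 = G 1 = 1, and c^2 delta = c gamma leaves one
    factor c in System B. *)
Lemma systemB_noise_stability (gamma alpha beta kappa nu : R) : 0 < gamma ->
  systemA Ftheta Fz ell phi gamma 1 alpha beta kappa nu ->
  exists F G : R -> R, [/\ noise_stability F, noise_stability G,
    F 1 = 1, G 1 = 1 &
    forall delta c etaG etaH, c * delta = gamma ->
      systemB Ftheta Fz ell phi delta c alpha beta kappa nu etaG etaH ->
      etaG = F (c * G etaG)].
Proof.
move=> g0 [[a0 b0 k0 n0] A1 A2 _ _]; rewrite mul1r in A2.
pose fr w := reg_score phi beta nu w.1 w.2.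
pose fl w := loss_score ell alpha kappa w.1 w.2.
have mfr : measurable_fun setT (fr : mR * mR -> R) by exact: measurable_reg_score.
have mfl : measurable_fun setT (fl : mR * mR -> R) by exact: measurable_loss_score.
have fr2 : (\int[(Ftheta \x stdnormal)%E]_w (fr w ^+ 2)%:E = (alpha ^+ 2)%:E)%E.
  by rewrite A1 unlock.
have fl2 : (\int[(Fz \x stdnormal)%E]_w (fl w ^+ 2)%:E = (beta ^+ 2 / gamma)%:E)%E.
  rewrite mulrC EFinM A2 unlock muleA -EFinM mulVf ?mul1e//.
  by rewrite gt_eqF.
have frF : (\int[(Ftheta \x stdnormal)%E]_w (fr w ^+ 2)%:E < +oo)%E.
  by rewrite fr2 ltry.
have flF : (\int[(Fz \x stdnormal)%E]_w (fl w ^+ 2)%:E < +oo)%E.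
  by rewrite fl2 ltry.
pose F rho := (alpha ^+ 2)^-1 * mixture_correlation Ftheta fr rho.
pose G rho := gamma / beta ^+ 2 * mixture_correlation Fz fl rho.
have a2 : 0 < alpha ^+ 2 by rewrite exprn_gt0.
have b2 : 0 < beta ^+ 2 by rewrite exprn_gt0.
exists F, G; split.
- apply: noise_stability_scale; first by rewrite invr_ge0 ltW.
  exact: mixture_noise_stability.
- apply: noise_stability_scale; first by rewrite divr_ge0 ?ltW.
  exact: mixture_noise_stability.
- have [F1] := etrans (mixture_correlation1 mfr frF) fr2.
  by rewrite /F F1 mulVf// gt_eqF.
- have [G1] := etrans (mixture_correlation1 mfl flF) fl2.
  by rewrite /G G1 mulrA divfK ?divff// gt_eqF.
- move=> delta c etaG etaH cd [eG eH B1 B2].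
  have [EG] : etaG%:E = (F etaH)%:E.
    rewrite B1 unlock /F EFinM; congr (_ * _)%E.
    exact: (mixture_correlation_EFin mfr frF eH).
  have [EH] : etaH%:E = (c * G etaG)%:E.
    rewrite B2 unlock.
    rewrite (_ : c * G etaG =
      c ^+ 2 * delta / beta ^+ 2 * mixture_correlation Fz fl etaG).
      rewrite [in RHS]EFinM; congr (_ * _)%E.
      exact: (mixture_correlation_EFin mfl flF eG).
    by rewrite /G -cd; ring.
  by rewrite -EH.
Qed.

End systems.
End scores.

(** * Monotonicity in delta of the optimal risk *)

Theorem proposition8 (R : realType)
    (Ftheta Fz : probability (measurableTypeR R) R)
    (ell : R -> R) (phi : R -> \bar R)
    (ell_pcc : proper_closed_convex (EFin \o ell))
    (ell_diff : forall x : R, derivable ell x 1)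
    (ell_lip : lipschitz ell^`()%classic)
    (ell_min : minimum_at (EFin \o ell) 0)
    (phi_pcc : proper_closed_convex phi)
    (phi_min : minimum_at phi 0)
    (reg : regularity Ftheta Fz ell phi)
    (alpha beta kappa nu etaG etaH : R -> R -> R)
    (solA : forall delta c : R, 0 < delta -> 0 < c < 1 ->
       systemA Ftheta Fz ell phi delta c
         (alpha delta c) (beta delta c) (kappa delta c) (nu delta c))
    (solB : forall delta c : R, 0 < delta -> 0 < c < 1 ->
       systemB Ftheta Fz ell phi delta c
         (alpha delta c) (beta delta c) (kappa delta c) (nu delta c)
         (etaG delta c) (etaH delta c))
    (M : option nat) (M_pos : M <> Some 0%N) :
  forall delta1 delta2 : R, 0 < delta1 -> delta1 <= delta2 ->
    (ereal_inf [set (limit_risk M (alpha delta2 c) (etaG delta2 c))%:E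
               | c in `]0%R, 1%R[ ]
     <= ereal_inf [set (limit_risk M (alpha delta1 c) (etaG delta1 c))%:E
                  | c in `]0%R, 1%R[ ])%E.
Proof.
(* Each risk at [delta1] is matched by a risk at [delta2] that is no larger. *)
move=> delta1 delta2 d1 d12; apply: le_ereal_inf_tmp => _ [c /= + <-].
rewrite in_itv/= => c01.
have d2 : 0 < delta2 by lra.
pose c' := c * delta1 / delta2.
have c'E : c' * delta2 = c * delta1 by rewrite /c' divfK// gt_eqF.
have c'0 : 0 < c' by rewrite /c' !mulr_gt0 ?invr_gt0//; lra.
have c'c : c' <= c by rewrite /c' ler_pdivrMr// ler_wpM2l//; lra.
have c'01 : 0 < c' < 1 by lra.
have A1 := solA delta1 c d1 c01; have A2 := solA delta2 c' d2 c'01.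
have systemAE delta c0 a b k n : systemA Ftheta Fz ell phi delta c0 a b k n =
    systemA Ftheta Fz ell phi (c0 * delta) 1 a b k n.
  by rewrite /systemA mul1r.
(* System A has the same equations at (delta2, c') and (delta1, c), so uniqueness identifies the two
   solutions. *)
have [_ _ uniq _] := reg; have [s [_ sU]] := uniq delta2 c' d2 c'01.
have := sU (alpha delta1 c, beta delta1 c, kappa delta1 c, nu delta1 c).
rewrite systemAE c'E -systemAE => /(_ A1) s1.
have := sU (alpha delta2 c', beta delta2 c', kappa delta2 c', nu delta2 c').
move=> /(_ A2) s2.
have [eqa eqb eqk eqn] :
  (alpha delta2 c', beta delta2 c', kappa delta2 c', nu delta2 c') =
  (alpha delta1 c, beta delta1 c, kappa delta1 c, nu delta1 c) by rewrite -s1 -s2.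
have B1 := solB delta1 c d1 c01; have B2 := solB delta2 c' d2 c'01.
rewrite eqa eqb eqk eqn in B2.
rewrite systemAE in A1.
have cd0 : 0 < c * delta1 by rewrite mulr_gt0//; lra.
have [F [G [FP GP F1 G1 FG]]] :=
  systemB_noise_stability ell_pcc ell_min phi_pcc phi_min cd0 A1.
have e1 := FG _ _ _ _ erefl B1; have e2 := FG _ _ _ _ c'E B2.
have [h1 _ _ _] := B1; have [h2 _ _ _] := B2.
have eta_le : etaG delta2 c' <= etaG delta1 c.
  by apply: (noise_fixpoint_le FP GP F1 G1 _ c'c _ h1 h2 e1 e2); lra.
apply: (@le_trans _ _ (limit_risk M (alpha delta2 c') (etaG delta2 c'))%:E).
  by apply: ereal_inf_lbound; exists c' => //=; rewrite in_itv.
rewrite lee_fin /limit_risk eqa lerD2l ler_wpM2l//.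
  by have := @inv_size_itv R M M_pos; lra.
by rewrite ler_wpM2r// sqr_ge0.
Qed.
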